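(* The marginal density path $p_t(x):=\int_{\mathbb{R}^d}p_t(x\mid x_1)p_1(x_1)\,\mathrm{d}x_1$ satisfies, for all $t\in(0,1)$ and $x\in\mathbb{R}^d$, $$\partial_tp_t(x)=-\nabla\cdot\bigl(p_t(x)u_t^*(x)\bigr),\qquad u_t^*(x):=\mathbb{E}[u_t(x\mid X_1)\mid X_t=x].$$ Hence the ODE $$\frac{\mathrm{d}X_t}{\mathrm{d}t}=u_t^*(X_t),\qquad X_0\sim p_0,$$ transports noise to data in forward time $t:0\to1$ (i.e. it generates the density path $p_t$, which runs from the noise distribution $p_0$ to the data distribution $p_1$).
   Context: Generative-time convention: $X_1\sim p_1=p_{\mathrm{data}}$ is a data sample in $\mathbb{R}^d$ with density $p_1$, and time $0$ corresponds to noise. Schedules: $\alpha_t,\sigma_t$ are differentiable functions on $[0,1]$ with $\alpha_0=0$, $\alpha_1=1$, $\sigma_0=1$, $\sigma_1=0$, $\alpha_t,\sigma_t\ge0$, and $\alpha_t>0$, $\sigma_t>0$ for $t\in(0,1)$; a dot denotes $\mathrm{d}/\mathrm{d}t$. Conditional path: $p_t(x\mid x_1):=\mathcal{N}(x;\alpha_tx_1,\sigma_t^2I)$, the conditional law of $X_t$ given $X_1=x_1$. Conditional velocity: $u_t(x\mid x_1):=\left(\dot\alpha_t-\frac{\dot\sigma_t}{\sigma_t}\alpha_t\right)x_1+\frac{\dot\sigma_t}{\sigma_t}x$. The conditional expectation given $X_t=x$ is with respect to the posterior density $p_t(x\mid x_1)p_1(x_1)/p_t(x)$ of $X_1$. Differential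 operators act on $x$. Convention: an ODE $\dot X_t=u_t(X_t)$ generates (transports along) the density path $p_t$ when $\partial_tp_t=-\nabla\cdot(p_tu_t)$. *)

(* Defs.v *)
From HB Require Import structures.
From mathcomp Require Import all_boot all_order all_algebra.
From mathcomp Require Import all_classical all_reals all_analysis.

Set Implicit Arguments.
Unset Strict Implicit.
Unset Printing Implicit Defensive.

Import Order.TTheory GRing.Theory Num.Theory.
Import numFieldNormedType.Exports.

Local Open Scope classical_set_scope.
Local Open Scope ring_scope.

(* The library provides the topology of ['rV[R]_d] but neither a sigma-algebra
   nor a Lebesgue measure on it.  The sigma-algebra is the one generated by the
   coordinates (as the library does for tuples), i.e. the Borel sets of R^d. *)

Section measurable_rV.
Variables (R : realType) (n : nat).

Definition rV_coord (i : 'I_n) (v : 'rV[R]_n) : R := v ord0 i.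

Let rV_set0 : g_sigma_preimage rV_coord set0.
Proof. exact: sigma_algebra0. Qed.

Let rV_setC A : g_sigma_preimage rV_coord A -> g_sigma_preimage rV_coord (~` A).
Proof. exact: sigma_algebraC. Qed.

Let rV_bigcup (F : (set 'rV[R]_n)^nat) :
  (forall i, g_sigma_preimage rV_coord (F i)) ->
  g_sigma_preimage rV_coord (\bigcup_i (F i)).
Proof. exact: sigma_algebra_bigcup. Qed.

HB.instance Definition _ := @isMeasurable.Build default_measure_display
  'rV[R]_n (g_sigma_preimage rV_coord) rV_set0 rV_setC rV_bigcup.

End measurable_rV.

Lemma measurable_rV_coord (R : realType) n (i : 'I_n) :
  measurable_fun [set: 'rV[R]_n] (@rV_coord R n i).
Proof.
move=> _ Y mY; rewrite setTI; apply: sub_sigma_algebra => /=.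
rewrite -bigcup_seq/=; exists i => /=; first by rewrite mem_index_enum.
by exists Y => //; rewrite setTI.
Qed.

Lemma measurable_fun_rVP d (T : measurableType d) (R : realType) n
    (f : T -> 'rV[R]_n) :
  measurable_fun [set: T] f <->
  forall i, measurable_fun [set: T] (@rV_coord R n i \o f).
Proof.
split=> [mf i|mf]; first exact: measurableT_comp (measurable_rV_coord i) mf.
have H : g_sigma_preimage (fun i => @rV_coord R n i \o f) `<=` measurable.
  apply: smallest_sub; first exact: sigma_algebra_measurable.
  rewrite -bigcup_seq; apply: bigcup_sub => i _.
  by move=> A [B mB <-]; exact: mf.
move: H; rewrite g_sigma_preimage_comp => H _ A mA.
by apply: H; exists A.
Qed.

Lemma sigma_finite_prod d1 d2 (T1 : measurableType d1) (T2 : measurableType d2)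
    (R : realType) (m1 : {sigma_finite_measure set T1 -> \bar R})
    (m2 : {sigma_finite_measure set T2 -> \bar R}) :
  sigma_finite setT (m1 \x m2)%E.
Proof.
have /sigma_finiteP[F [TF ndF Foo]] := sigma_finiteT m1.
have /sigma_finiteP[G [TG ndG Goo]] := sigma_finiteT m2.
exists (fun n => F n `*` G n).
  rewrite -setXTT TF TG predeqE => -[x y]; split.
    move=> [/= [n _ Fnx] [k _ Gky]]; exists (maxn n k) => //; split.
    - by move: x Fnx; exact/subsetPset/ndF/leq_maxl.
    - by move: y Gky; exact/subsetPset/ndG/leq_maxr.
  by move=> [n _ []/= ? ?]; split; exists n.
move=> k; have [? ?] := Foo k; have [? ?] := Goo k.
split; first exact: measurableX.
by rewrite product_measure1E// lte_mul_pinfty// ge0_fin_numE.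
Qed.

Section lebesgue_rV.
Variable R : realType.

Definition rV_cons n (xv : measurableTypeR R * 'rV[R]_n) : 'rV[R]_n.+1 :=
  row_mx (const_mx xv.1 : 'rV[R]_1) xv.2.

Lemma measurable_rV_cons n :
  measurable_fun [set: measurableTypeR R * 'rV[R]_n] (@rV_cons n).
Proof.
apply/measurable_fun_rVP => i.
case: (@split_ordP 1 n i) => j ->.
  rewrite [X in measurable_fun _ X](_ : _ = fst); first exact: measurable_fst.
  by apply/funext => xv; rewrite /rV_coord /rV_cons [LHS](@row_mxEl _ 1 1 n) mxE.
rewrite [X in measurable_fun _ X](_ : _ = @rV_coord R n j \o snd).
  exact: measurableT_comp (measurable_rV_coord j) measurable_snd.
by apply/funext => xv; rewrite /rV_coord /rV_cons [LHS](@row_mxEr _ 1 1 n).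
Qed.

Definition rV_uncons n (v : 'rV[R]_n.+1) : measurableTypeR R * 'rV[R]_n :=
  (v ord0 ord0, rsubmx (v : 'rV[R]_(1 + n))).

Lemma measurable_rV_uncons n :
  measurable_fun [set: 'rV[R]_n.+1] (@rV_uncons n).
Proof.
apply/measurable_fun_pairP; split; first exact: (measurable_rV_coord ord0).
apply/measurable_fun_rVP => i.
rewrite [X in measurable_fun _ X](_ : _ = @rV_coord R n.+1 (rshift 1 i)).
  exact: measurable_rV_coord.
by apply/funext => v /=; rewrite /rV_coord mxE.
Qed.

Lemma rV_consK n : cancel (@rV_cons n) (@rV_uncons n).
Proof.
move=> [x v]; rewrite /rV_uncons /rV_cons row_mxKr; congr pair.
have -> : (ord0 : 'I_n.+1) = lshift n (ord0 : 'I_1) by exact: val_inj.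
by rewrite (@row_mxEl _ 1 1 n) mxE.
Qed.

Section cons_measure.
Variable n : nat.
Variable mu : {sigma_finite_measure set 'rV[R]_n -> \bar R}.

Definition cons_measure : set 'rV[R]_n.+1 -> \bar R :=
  pushforward (@lebesgue_measure R \x mu)%E (@rV_cons n).

Let cons_measure_measure : {measure set 'rV[R]_n.+1 -> \bar R} :=
  measure_function_pushforward__canonical__measure_function_Measure
    (@lebesgue_measure R \x mu)%E (@measurable_rV_cons n).

HB.instance Definition _ := Measure.copy cons_measure cons_measure_measure.

Let cons_measure_sigma_finite : sigma_finite setT cons_measure.
Proof.
have [F UF mF] := sigma_finite_prod (@lebesgue_measure R) mu.
exists (fun k => @rV_uncons n @^-1` F k).
  by rewrite -preimage_bigcup -UF preimage_setT.
move=> k; have [mFk Fkoo] := mF k; split.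
  by rewrite -[X in measurable X]setTI; exact: measurable_rV_uncons.
rewrite /cons_measure /pushforward -comp_preimage.
by rewrite (_ : _ \o _ = id) //; apply/funext => x /=; rewrite rV_consK.
Qed.

HB.instance Definition _ :=
  Measure_isSigmaFinite.Build _ _ _ cons_measure cons_measure_sigma_finite.

End cons_measure.

Fixpoint lebesgue_rV (n : nat) : {sigma_finite_measure set 'rV[R]_n -> \bar R} :=
  match n with
  | 0 => \d_(0 : 'rV[R]_0)
  | n'.+1 => cons_measure (lebesgue_rV n')
  end.

End lebesgue_rV.

Lemma lebesgue_rV_box (R : realType) n (A : 'I_n -> set R) :
  (forall i, measurable (A i)) ->
  lebesgue_rV R n [set v | forall i, A i (v ord0 i)] =
  (\prod_(i < n) lebesgue_measure (A i))%E.
Proof.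
elim: n A => [|n IH] A mA.
  rewrite big_ord0 /= diracE (_ : _ \in _ = true) //.
  by apply/mem_set => -[].
have mB : measurable [set v : 'rV[R]_n | forall i, A (lift ord0 i) (v ord0 i)].
  rewrite [X in measurable X](_ : _ = \bigcap_(i in [set: 'I_n])
    (@rV_coord R n i @^-1` A (lift ord0 i))).
    apply: fin_bigcap_measurable => // i _.
    by rewrite -[X in measurable X]setTI; exact: measurable_rV_coord.
  by apply/seteqP; split => [v /= Av i _|v /= Av i]; exact: Av.
have := @product_measure1E _ _ _ _ R (@lebesgue_measure R) (lebesgue_rV R n)
  _ _ (mA ord0) mB.
rewrite big_ord_recl (IH (fun i => A (lift ord0 i))) => [<-|i]; last exact: mA.
rewrite /= /cons_measure /pushforward; congr (_ _).
have c0 (x : R) v : @rV_cons R n (x, v) ord0 ord0 = x.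
  have -> : (ord0 : 'I_n.+1) = lshift n (ord0 : 'I_1) by exact: val_inj.
  by rewrite /rV_cons (@row_mxEl _ 1 1 n) mxE.
have cS (x : R) v i : @rV_cons R n (x, v) ord0 (lift ord0 i) = v ord0 i.
  have -> : lift ord0 i = rshift 1 i :> 'I_n.+1 by exact: val_inj.
  by rewrite /rV_cons (@row_mxEr _ 1 1 n).
apply/seteqP; split=> -[x v] /=.
  by move=> H; split=> [|i]; [move: (H ord0); rewrite c0
                             |move: (H (lift ord0 i)); rewrite cS].
move=> [H0 HS] i; case: (unliftP ord0 i) => [j|] ->; rewrite ?c0 ?cS //.
Qed.

Section densities.
Variables (R : realType) (d : nat).

Definition is_density (p : 'rV[R]_d -> R) : Prop :=
  [/\ measurable_fun setT p, forall x, 0 <= p x &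
      (\int[lebesgue_rV R d]_x (p x)%:E)%E = 1%E].

(* Density of N(m, s^2 I) for [s != 0]; [normal_peak s] is
   1 / sqrt (2 pi s^2). *)
Definition gauss_pdf (m : 'rV[R]_d) (s : R) (x : 'rV[R]_d) : R :=
  normal_peak s ^+ d *
  expR (- (\sum_(i < d) (x ord0 i - m ord0 i) ^+ 2) / (s ^+ 2 *+ 2)).

Definition divergence (F : 'rV[R]_d -> 'rV[R]_d) (x : 'rV[R]_d) : R :=
  \sum_(i < d) 'D_(delta_mx ord0 i) (fun y => F y ord0 i : R) x.

(* [derive1] and ['D_v f x] are total functions, hence the explicit requirement
   that all the partial derivatives involved exist. *)
Definition continuity_equation (p : R -> 'rV[R]_d -> R)
    (u : R -> 'rV[R]_d -> 'rV[R]_d) (t : R) (x : 'rV[R]_d) : Prop :=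
  [/\ derivable (fun s => p s x) t 1,
      forall i, derivable (fun y => (p t y *: u t y) ord0 i : R) x
                  (delta_mx ord0 i) &
      derive1 (fun s => p s x) t = - divergence (fun y => p t y *: u t y) x].

(* The ODE dX_t/dt = u_t(X_t) generates the density path p on ]0, 1[. *)
Definition generates (u : R -> 'rV[R]_d -> 'rV[R]_d)
    (p : R -> 'rV[R]_d -> R) : Prop :=
  forall (t : R) (x : 'rV[R]_d), 0 < t < 1 -> continuity_equation p u t x.

Definition weakly_converges (F : set_system R) (p : R -> 'rV[R]_d -> R)
    (q : 'rV[R]_d -> R) : Prop :=
  forall f : 'rV[R]_d -> R, continuous f -> (exists M : R, forall x, `|f x| <= M) ->
  \int[lebesgue_rV R d]_x (f x * p s x) @[s --> F] -->
  \int[lebesgue_rV R d]_x (f x * q x).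

(* The endpoints are tied to the path on ]0, 1[ by weak convergence: the
   formula defining the path need not make sense at t = 1, where the
   conditional laws degenerate to Dirac masses. *)
Definition transports (u : R -> 'rV[R]_d -> 'rV[R]_d)
    (p : R -> 'rV[R]_d -> R) (q0 q1 : 'rV[R]_d -> R) : Prop :=
  [/\ generates u p, weakly_converges 0^'+ p q0 & weakly_converges 1^'- p q1].

End densities.

(* One-sided at the endpoints of an interval [A]. *)
Definition differentiable_within (R : realType) (A : set R) (f : R -> R) :=
  forall t, A t -> cvg ((f s - f t) / (s - t) @[s --> within A t^']).

Record schedules (R : realType) (alpha sigma : R -> R) : Prop := Schedules {
  schedules_alpha_diff : differentiable_within `[0, 1] alpha ;
  schedules_sigma_diff : differentiable_within `[0, 1] sigma ;
  schedules_alpha0 : alpha 0 = 0 ;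
  schedules_alpha1 : alpha 1 = 1 ;
  schedules_sigma0 : sigma 0 = 1 ;
  schedules_sigma1 : sigma 1 = 0 ;
  schedules_alpha_ge0 : forall t, 0 <= t <= 1 -> 0 <= alpha t ;
  schedules_sigma_ge0 : forall t, 0 <= t <= 1 -> 0 <= sigma t ;
  schedules_alpha_gt0 : forall t, 0 < t < 1 -> 0 < alpha t ;
  schedules_sigma_gt0 : forall t, 0 < t < 1 -> 0 < sigma t }.

Section flow_matching.
Variables (R : realType) (d : nat) (alpha sigma : R -> R).
Variable p1 : 'rV[R]_d -> R.
Implicit Types (t : R) (x y : 'rV[R]_d).

(* In this section [y] stands for a value of X_1, and [x] for a value of X_t. *)

Definition cond_pdf t y x : R := gauss_pdf (alpha t *: y) (sigma t) x.

Definition cond_velocity t y x : 'rV[R]_d :=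
  (derive1 alpha t - derive1 sigma t / sigma t * alpha t) *: y
  + (derive1 sigma t / sigma t) *: x.

Definition marginal_pdf t x : R :=
  \int[lebesgue_rV R d]_y (cond_pdf t y x * p1 y).

Definition posterior_pdf t x y : R :=
  cond_pdf t y x * p1 y / marginal_pdf t x.

(* E[F(X_1) | X_t = x] *)
Definition posterior_expectation t x (F : 'rV[R]_d -> 'rV[R]_d) : 'rV[R]_d :=
  \row_(i < d) \int[lebesgue_rV R d]_y (F y ord0 i * posterior_pdf t x y).

Definition marginal_velocity t x : 'rV[R]_d :=
  posterior_expectation t x (fun y => cond_velocity t y x).

(* [Rintegral] and division are total: this says that no default value
   enters [marginal_pdf t x] and [marginal_velocity t x]. *)
Definition marginals_well_defined t x : Prop :=
  [/\ (lebesgue_rV R d).-integrable setT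
        (fun y => (cond_pdf t y x * p1 y)%:E),
      0 < marginal_pdf t x &
      forall i, (lebesgue_rV R d).-integrable setT
        (fun y => (cond_velocity t y x ord0 i * posterior_pdf t x y)%:E)].

End flow_matching.

(* Main.v *)
(** Writing X = x / sigma_t and b = alpha_t / sigma_t, the conditional density
    is a multiple, depending on t only, of exp(- |X - b y|^2 / 2), so p_t and
    the flux p_t u_t^* are combinations of the integrals of 1 and y_i against
    exp(- |X - b y|^2 / 2) p1(y).  They are differentiated under the integral
    sign, and both sides of the continuity equation become the same
    combination of the moments 1, y_i and y_i^2.  The schedules are only
    differentiable, so their derivatives may be unbounded near t; the
    domination thus comes from a Lipschitz estimate of the kernel in (X, b),
    uniform in y because b stays away from 0.

    At the endpoints, Tonelli and the substitution x = alpha_t y + sigma_t z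
    give E[f(X_t)] as the integral of f(alpha_t y + sigma_t z) against p1(y)
    times the standard Gaussian density of z, and dominated convergence lets
    t tend to 0 or 1. *)
Require Import Defs.
From mathcomp Require Import all_boot all_order all_algebra.
From mathcomp Require Import all_classical all_reals all_analysis.
From mathcomp Require Import measurable_realfun.
From mathcomp Require Import ring lra.
Import Order.TTheory GRing.Theory Num.Theory.
Import numFieldNormedType.Exports.
Local Open Scope classical_set_scope.
Local Open Scope ring_scope.
Set Implicit Arguments.
Unset Strict Implicit.
Unset Printing Implicit Defensive.

(** * Integration *)

Section real_integrable.
Context d (T : measurableType d) (R : realType).
Variable mu : {measure set T -> \bar R}.
Implicit Types f g : T -> R.

Lemma integrable_EFinD f g : mu.-integrable setT (EFin \o f) ->
  mu.-integrable setT (EFin \o g) ->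
  mu.-integrable setT (EFin \o (fun x => f x + g x)).
Proof.
move=> fi gi; rewrite /comp; under eq_fun do rewrite EFinD.
exact: integrableD.
Qed.

Lemma integrable_EFinB f g : mu.-integrable setT (EFin \o f) ->
  mu.-integrable setT (EFin \o g) ->
  mu.-integrable setT (EFin \o (fun x => f x - g x)).
Proof.
move=> fi gi; rewrite /comp; under eq_fun do rewrite EFinB.
exact: integrableB.
Qed.

Lemma integrable_EFinZl (k : R) f : mu.-integrable setT (EFin \o f) ->
  mu.-integrable setT (EFin \o (fun x => k * f x)).
Proof.
move=> fi; rewrite /comp; under eq_fun do rewrite EFinM.
exact: integrableZl.
Qed.

Lemma le_integrable_EFin f g : measurable_fun setT f ->
  (forall x, `|f x| <= g x) -> mu.-integrable setT (EFin \o g) ->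
  mu.-integrable setT (EFin \o f).
Proof.
move=> mf fg; apply: le_integrable => //; first exact/measurable_EFinP.
by move=> x _ /=; rewrite lee_fin (le_trans (fg x))// ler_norm.
Qed.

(** Integrability is carried along with the value because additivity of the integral asks for it at
    each step of the induction. *)
Lemma Rintegral_sum (I : Type) (s : seq I) (F : I -> T -> R) :
  (forall i, mu.-integrable setT (EFin \o F i)) ->
  mu.-integrable setT (EFin \o (fun x => \sum_(i <- s) F i x)) /\
  \int[mu]_x (\sum_(i <- s) F i x) = \sum_(i <- s) \int[mu]_x F i x.
Proof.
move=> Fi; elim: s => [|i s [IHi IH]].
  have -> : (fun x => \sum_(i <- [::]) F i x) = cst 0.
    by apply/funext => x; rewrite big_nil.
  split; first exact: integrable0.
  by rewrite big_nil /Rintegral integral0.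
have -> : (fun x => \sum_(j <- i :: s) F j x) =
    (fun x => F i x + \sum_(j <- s) F j x).
  by apply/funext => x; rewrite big_cons.
by split; [exact: integrable_EFinD|rewrite big_cons RintegralD// IH].
Qed.

End real_integrable.

(** The limit is itself dominated by [g], so its extended integral is finite and [fine] passes
    through the limit. *)
Lemma dominated_cvg_Rintegral d (T : measurableType d) (R : realType)
    (mu : {measure set T -> \bar R}) (f_ : nat -> T -> R) (f g : T -> R) :
  (forall n, measurable_fun setT (f_ n)) ->
  (forall x, f_ n x @[n --> \oo] --> f x) ->
  mu.-integrable setT (EFin \o g) ->
  (forall n x, `|f_ n x| <= g x) ->
  \int[mu]_x f_ n x @[n --> \oo] --> \int[mu]_x f x.
Proof.
move=> mf f_f ig fg.
have mfE n : measurable_fun setT (fun x => (f_ n x)%:E).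
  exact/measurable_EFinP.
have f_fE x : setT x -> (f_ n x)%:E @[n --> \oo] --> (f x)%:E.
  by move=> _; apply: cvg_EFin; [exact: nearW|exact: f_f].
have fgE n x : setT x -> (`|(f_ n x)%:E| <= (g x)%:E)%E.
  by move=> _; rewrite lee_fin fg.
apply: fine_cvg; rewrite fineK.
  exact: (@dominated_cvg _ _ _ mu setT measurableT _ _ (EFin \o g)).
apply: integrable_fin_num => //.
exact: (@lebesgue_integral_dominated_convergence.dominated_integrable _ _ _ mu
  setT measurableT (fun n => EFin \o f_ n)
  (EFin \o f) (EFin \o g)).
Qed.

(* Domination is only asked of the difference quotients at [a], so that [f]
   need not be differentiable in [x] away from [a]. *)
Lemma is_derive_Rintegral d (T : measurableType d) (R : realType)
    (mu : {measure set T -> \bar R}) (f : R -> T -> R) (a : R) (f' g : T -> R) :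
  (forall y, is_derive a 1 (f ^~ y) (f' y)) ->
  mu.-integrable setT (EFin \o g) ->
  (\forall x \near a, mu.-integrable setT (EFin \o f x) /\
     forall y, `|f x y - f a y| <= g y * `|x - a|) ->
  is_derive a 1 (fun x => \int[mu]_y f x y) (\int[mu]_y f' y).
Proof.
move=> df ig nf.
suff H : h^-1 *: (\int[mu]_y f (h + a) y - \int[mu]_y f a y) @[h --> 0^'] -->
    \int[mu]_y f' y.
  have H' : h^-1 *: (\int[mu]_y f (h *: 1 + a) y - \int[mu]_y f a y)
      @[h --> 0^'] --> \int[mu]_y f' y.
    by under eq_fun do rewrite [_ *: 1]mulr1.
  by apply: DeriveDef; [apply/cvg_ex; eexists; exact: H'|exact/cvg_lim].
(* Dominated convergence is about sequences, so the limit is tested along an arbitrary sequence of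
   nonzero increments; its first [N] terms are dropped to stay where the domination holds. *)
apply/cvgr_dnbhsP => t [t0 tc].
have intfa : mu.-integrable setT (EFin \o f a) by case: (nbhs_singleton nf).
have tac : t n + a @[n --> \oo] --> a.
  by rewrite -[X in _ --> X]add0r; apply: cvgD => //; exact: cvg_cst.
have [N _ tN] := tac _ nf.
rewrite -(cvg_shiftn N).
have Ht n : mu.-integrable setT (EFin \o f (t (n + N)%N + a)) /\
     forall y, `|f (t (n + N)%N + a) y - f a y| <= g y * `|t (n + N)%N|.
  have [] := tN (n + N)%N (leq_addl _ _); rewrite addrK; by [].
have -> : (fun n => (t (n + N)%N)^-1 *:
      (\int[mu]_y f (t (n + N)%N + a) y - \int[mu]_y f a y)) =
   (fun n => \int[mu]_y ((t (n + N)%N)^-1 * (f (t (n + N)%N + a) y - f a y))).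
  apply/funext => n; have [int_n _] := Ht n.
  rewrite -RintegralB// RintegralZl//.
  exact: integrable_EFinB.
apply: (@dominated_cvg_Rintegral _ _ _ mu _ _ g) => //.
- move=> n; have [/integrableP[/measurable_EFinP mfn _] _] := Ht n.
  have /integrableP[/measurable_EFinP mfa _] := intfa.
  by apply: measurable_funM; [exact: measurable_cst|exact: measurable_funB].
- move=> y; have [dfy dfE] := df y.
  move: dfy => /cvg_ex[/= l fl].
  have ly : f' y = l by rewrite -dfE; exact/cvg_lim.
  move: fl => /cvgr_dnbhsP/(_ _ (conj t0 tc)).
  rewrite -(cvg_shiftn N) -ly.
  by under [in X in X -> _]eq_fun do rewrite [_ *: 1]mulr1.
- move=> n y; have [_ /(_ y)] := Ht n.
  move=> H; rewrite normrM normfV [leLHS]mulrC ler_pdivrMr//.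
  by rewrite normr_gt0.
Qed.

(** Near [a] the difference quotients are within 1 of the derivative [l], hence bounded by
    [1 + |l|]. One endpoint of the increment stays at [a], which is all that differentiability at a
    single point provides. *)
Lemma derivable_lipschitz_at (R : realType) (f : R -> R) (a : R) :
  derivable f a 1 ->
  exists2 L, 0 < L & \forall x \near a, `|f x - f a| <= L * `|x - a|.
Proof.
move=> /cvg_ex[/= l /cvgrPdist_le/(_ 1 ltr01) [r /= r0 H]].
exists (1 + `|l|); first by rewrite ltr_pwDl.
exists r => //= x /=; rewrite (distrC a) => xar.
have [->|xa] := eqVneq x a; first by rewrite !subrr normr0 mulr0.
have := H (x - a); rewrite /= sub0r normrN => /(_ xar).
rewrite subr_eq0 => /(_ xa).
rewrite [_ *: 1]mulr1 subrK => {}H.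
rewrite -ler_pdivrMr ?normr_gt0 ?subr_eq0// -normfV -normrM mulrC.
rewrite -[(x - a)^-1 * _](subrK l) (le_trans (ler_normD _ _))// lerD2r distrC.
exact: H.
Qed.

Lemma derivable_continuous_at (R : realType) (f : R -> R) (a : R) :
  derivable f a 1 -> f x @[x --> a] --> f a.
Proof. by move=> /derivable1_diffP; exact: differentiable_continuous. Qed.

(** * Lebesgue and Gaussian measures on R^n *)

Section lebesgue_rV_affine.
Variable R : realType.
Local Open Scope ereal_scope.

(** By construction the measure is the image of a product measure, so Tonelli splits off the first
    coordinate. *)
Lemma ge0_integral_rV_cons n (f : 'rV[R]_n.+1 -> \bar R) :
  measurable_fun setT f -> (forall v, 0 <= f v) ->
  \int[lebesgue_rV R n.+1]_v f v =
  \int[@lebesgue_measure R]_x \int[lebesgue_rV R n]_v f (rV_cons (x, v)).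
Proof.
move=> mf f0.
rewrite (_ : \int[lebesgue_rV R n.+1]_v f v =
   \int[pushforward (@lebesgue_measure R \x lebesgue_rV R n)
     (@rV_cons R n)]_v f v)//.
rewrite ge0_integral_pushforward//; last exact: measurable_rV_cons.
have mfc := measurableT_comp mf (@measurable_rV_cons R n).
by rewrite preimage_setT (fubini_tonelli1 _ mfc) => [//|v]; exact: f0.
Qed.

Lemma measurable_affine (m s : R) :
  measurable_fun setT
    (fun x : measurableTypeR R => m + s * x : measurableTypeR R)%R.
Proof.
apply: measurable_funD; first exact: measurable_cst.
by apply: measurable_funM; [exact: measurable_cst|exact: measurable_id].
Qed.

Lemma ge0_integral_affine (f : measurableTypeR R -> \bar R) (m s : R) :
  (0 < s)%R -> measurable_fun setT f -> (forall x, 0 <= f x) ->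
  \int[@lebesgue_measure R]_x f x =
  s%:E * \int[@lebesgue_measure R]_x f (m + s * x)%R.
Proof.
move=> s0 mf f0.
pose T (x : measurableTypeR R) : measurableTypeR R := (m + s * x)%R.
have mT : measurable_fun setT T by exact: measurable_affine.
have snn : (0 <= s)%R by exact: ltW.
pose mu := measure_function_pushforward__canonical__measure_function_Measure
   (mscale (NngNum snn) (@lebesgue_measure R)) mT.
(* Lebesgue measure is determined by half-open intervals, on which the scaled image measure has the
   same value. *)
have E A : measurable A -> lebesgue_measure A = mu A.
  apply: lebesgue_measure_unique => _ [[a b] _ <-] /=.
  rewrite /mu /= /pushforward /mscale /=.
  have -> : T @^-1` `]a, b] = `]((a - m) / s)%R, ((b - m) / s)%R]%classic.
    apply/seteqP; split => x /=;
      rewrite /T !in_itv/= ltr_pdivrMr// ler_pdivlMr//.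
      by lra.
    by lra.
  rewrite !lebesgue_measure_itv/= !lte_fin ltr_pM2r ?invr_gt0// ltrBlDr subrK.
  case: ifPn => _; last by rewrite mule0.
  rewrite -!EFinB -EFinM; congr EFin; field.
  by rewrite gt_eqF.
rewrite (eq_measure_integral mu) => [|A mA _]; last exact: E.
rewrite ge0_integral_pushforward//.
rewrite preimage_setT ge0_integral_mscale// => [|x _]; last exact: f0.
exact: measurableT_comp.
Qed.

Lemma measurable_rV_affine n (m : 'rV[R]_n) (s : R) :
  measurable_fun setT (fun v : 'rV[R]_n => m + s *: v)%R.
Proof.
apply/measurable_fun_rVP => i.
rewrite (_ : _ \o _ = (fun v : 'rV[R]_n => m ord0 i + s * v ord0 i)%R); last first.
  by apply/funext => v; rewrite /rV_coord /= !mxE.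
apply: measurable_funD; first exact: measurable_cst.
by apply: measurable_funM; [exact: measurable_cst|exact: measurable_rV_coord].
Qed.

Lemma rV_consEl n (x : R) (v : 'rV[R]_n) (j : 'I_1) :
  rV_cons (x, v) ord0 (lshift n j) = x.
Proof. by rewrite /rV_cons [LHS](@row_mxEl _ 1 1 n) mxE. Qed.

Lemma rV_consEr n (x : R) (v : 'rV[R]_n) (j : 'I_n) :
  rV_cons (x, v) ord0 (rshift 1 j) = v ord0 j.
Proof. by rewrite /rV_cons [LHS](@row_mxEr _ 1 1 n). Qed.

Lemma rV_cons_affine n (m : 'rV[R]_n.+1) (s x : R) (v : 'rV[R]_n) :
  (m + s *: rV_cons (x, v))%R =
  rV_cons ((rV_uncons m).1 + s * x, (rV_uncons m).2 + s *: v)%R.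
Proof.
apply/rowP => i; rewrite [LHS]mxE [X in (_ + X)%R = _]mxE.
case: (@split_ordP 1 n i) => j ->.
  rewrite !rV_consEl /=; congr (m _ _ + _)%R.
  by apply: val_inj; rewrite /= ord1.
by rewrite !rV_consEr /= !mxE.
Qed.

(** Induction on the dimension: the first coordinate contributes a factor [s] by the one-dimensional
    substitution, the others [s ^+ n]. *)
Lemma ge0_integral_rV_affine n (f : 'rV[R]_n -> \bar R) (m : 'rV[R]_n) (s : R) :
  (0 < s)%R -> measurable_fun setT f -> (forall v, 0 <= f v) ->
  \int[lebesgue_rV R n]_v f v =
  (s ^+ n)%:E * \int[lebesgue_rV R n]_v f (m + s *: v)%R.
Proof.
move=> s0; elim: n f m => [|n IH] f m mf f0.
  rewrite expr0 mul1e; congr (integral _ _ _); apply/funext => v; congr f.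
  by apply/rowP => -[].
have mc (x : R) : measurable_fun setT (fun v : 'rV[R]_n => rV_cons (x, v)).
  apply: measurableT_comp; first exact: measurable_rV_cons.
  exact: measurable_pair1.
rewrite ge0_integral_rV_cons//.
rewrite (@ge0_integral_affine _ (rV_uncons m).1 s)//; first last.
- by move=> x; apply: integral_ge0.
- apply: (measurable_fun_fubini_tonelli_F (f \o @rV_cons R n)); last first.
    by move=> v; exact: f0.
  exact: (measurableT_comp mf (@measurable_rV_cons R n)).
have mfa := measurableT_comp mf (measurable_rV_affine m s).
rewrite (ge0_integral_rV_cons mfa (fun v => f0 _)).
under eq_integral => x _.
  rewrite (IH _ (rV_uncons m).2)//; last exact: (measurableT_comp mf (mc _)).
  under eq_integral => v _ do rewrite -rV_cons_affine.
  over.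
rewrite ge0_integralZl//.
- by rewrite muleA -EFinM -exprS.
- apply: (measurable_fun_fubini_tonelli_F
    ((fun v => f (m + s *: v)%R) \o @rV_cons R n)); last first.
    by move=> v; exact: f0.
  exact: (measurableT_comp mfa (@measurable_rV_cons R n)).
- by move=> x _; apply: integral_ge0.
- by rewrite lee_fin exprn_ge0// ltW.
Qed.

End lebesgue_rV_affine.

(** * Borel sets and continuous functions on R^n *)

Section rV_borel.
Variables (R : realType) (n : nat).

Let rV_box (qk : 'rV[rat]_n * nat) : set 'rV[R]_n :=
  [set v | forall i, `|ratr (qk.1 ord0 i) - v ord0 i| < qk.2.+1%:R^-1].

Let measurable_rV_box qk : measurable (rV_box qk).
Proof.
rewrite [X in measurable X](_ : _ = \bigcap_(i in [set: 'I_n])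
  (@rV_coord R n i @^-1` [set x | `|ratr (qk.1 ord0 i) - x| < qk.2.+1%:R^-1])).
  apply: fin_bigcap_measurable => // i _.
  rewrite -[X in measurable X]setTI; apply: measurable_rV_coord => //.
  set r := _^-1; set q := ratr _.
  rewrite (_ : [set x | _] = `]q - r, q + r[%classic) //.
  by apply/seteqP; split => x /=; rewrite in_itv/= ltr_distlC.
by apply/seteqP; split => [v /= Hv i _|v /= Hv i]; exact: Hv.
Qed.

(** An open set is the union of the boxes with rational center and radius [1 / (k + 1)] that it
    contains; there are countably many, each measurable coordinate by coordinate. *)
Lemma open_measurable_rV (U : set 'rV[R]_n) : open U -> measurable U.
Proof.
move=> oU.
rewrite [X in measurable X](_ : U = \bigcup_(qk : 'rV[rat]_n * nat)
    (if `[< rV_box qk `<=` U >] then rV_box qk else set0)).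
  apply: countable_bigcupT_measurable => [|qk]; first exact: countableP.
  by case: ifP.
apply/seteqP; split => [v Uv|v [qk _]]; last by case: ifPn => // /asboolP; exact.
move: oU; rewrite openE => /(_ _ Uv) /nbhs_ballP [e /= e0 eU].
(* Half of [e] suffices: the box has a center closer to [v] than its radius, so all its points are
   within twice the radius of [v]. *)
have [k ke] : exists k, k.+1%:R^-1 < e / 2.
  exists (Num.truncn (e / 2)^-1).
  rewrite -[ltRHS]invrK ltf_pV2 ?posrE ?invr_gt0 ?divr_gt0//.
  exact: truncnS_gt.
have k0 : 0 < k.+1%:R^-1 :> R by rewrite invr_gt0.
have /choice[q qP] i : exists q : rat, `|ratr q - v ord0 i| < k.+1%:R^-1.
  have : v ord0 i - k.+1%:R^-1 < v ord0 i + k.+1%:R^-1 by rewrite ltrD2l gtrN.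
  move=> /rat_in_itvoo[q]; rewrite in_itv/= => qv; exists q.
  by rewrite ltr_distl.
exists (\row_i q i, k) => //=.
have vb : rV_box (\row_i q i, k) v by move=> i /=; rewrite mxE.
rewrite ifT//; apply/asboolP => w wb; apply: eU; split => // i j.
rewrite ord1 -ball_normE /=.
have := wb j; have := vb j; rewrite /= mxE => vj wj.
apply: (le_lt_trans (ler_distD (ratr (q j)) _ _)).
rewrite (distrC (v _ _)); set r := _^-1 in vj wj ke; lra.
Qed.

Lemma continuous_measurable_rV (f : 'rV[R]_n -> R) :
  continuous f -> measurable_fun setT f.
Proof.
move=> /continuousP cf.
apply: (measurability _ (RGenOInfty.measurableE R)) => _ [_ [a ->] <-].
rewrite setTI; apply: open_measurable_rV; apply: cf.
by rewrite set_itvE; exact: open_gt.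
Qed.

End rV_borel.

(** * Gaussian densities: normalization and affine substitution *)

Section standard_gaussian.
Variable R : realType.

Lemma normal_peakE (s : R) : 0 < s -> normal_peak s = normal_peak 1 / s.
Proof.
move=> s0; rewrite /normal_peak expr1n mul1r -mulrnAr.
by rewrite sqrtrM ?sqr_ge0// sqrtr_sqr gtr0_norm// invfM mulrC.
Qed.

Lemma gauss_pdf_ge0 n (m : 'rV[R]_n) s x : 0 <= gauss_pdf m s x.
Proof. by rewrite mulr_ge0 ?expR_ge0// exprn_ge0// normal_peak_ge0. Qed.

Lemma measurable_gauss_pdf n (m : 'rV[R]_n) s : measurable_fun setT (gauss_pdf m s).
Proof.
apply: measurable_funM; first exact: measurable_cst.
apply: measurableT_comp => //; apply: measurable_funM; last exact: measurable_cst.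
apply: measurableT_comp => //; apply: measurable_sum => i.
apply: measurable_funX; apply: measurable_funB; last exact: measurable_cst.
exact: measurable_rV_coord.
Qed.

Lemma gauss_pdf_center n (m x : 'rV[R]_n) s :
  gauss_pdf m s x = gauss_pdf 0 s (x - m).
Proof.
rewrite /gauss_pdf; under [in RHS]eq_bigr do rewrite !mxE subr0.
by [].
Qed.

(** The Jacobian [s ^+ n] of the substitution cancels the factor [s ^- n] of the peak. *)
Lemma gauss_pdf_affine n (m z : 'rV[R]_n) s : 0 < s ->
  s ^+ n * gauss_pdf m s (m + s *: z) = gauss_pdf 0 1 z.
Proof.
move=> s0; have s0' : s != 0 by rewrite gt_eqF.
rewrite /gauss_pdf (normal_peakE s0) mulrA -exprMn (mulrC s) divfK//.
congr (_ * expR _); rewrite !mulNr; congr -%R.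
rewrite expr1n !mulr_suml; apply: eq_bigr => i _; rewrite !mxE.
by field.
Qed.

Lemma gauss_pdf_cons n (x : R) (v : 'rV[R]_n) :
  gauss_pdf 0 1 (rV_cons (x, v)) = normal_pdf 0 1 x * gauss_pdf 0 1 v.
Proof.
rewrite normal_pdfE ?oner_eq0// /normal_fun /gauss_pdf exprS.
rewrite [RHS]mulrACA -expRD; congr (_ * expR _).
rewrite big_ord_recl.
have E0 : rV_cons (x, v) ord0 ord0 = x.
  rewrite -[RHS](rV_consEl x v ord0); congr (rV_cons _ _ _); exact: val_inj.
have ES i : rV_cons (x, v) ord0 (lift ord0 i) = v ord0 i.
  rewrite -[RHS](rV_consEr x v i); congr (rV_cons _ _ _); exact: val_inj.
rewrite E0 mxE; under eq_bigr do rewrite ES mxE.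
under [in RHS]eq_bigr do rewrite mxE.
by rewrite opprD mulrDl -!mulNr.
Qed.

Lemma integral_gauss_pdf01 n :
  (\int[lebesgue_rV R n]_z (gauss_pdf 0 1 z)%:E = 1)%E.
Proof.
elim: n => [|n IH].
  rewrite integral_dirac//; last first.
    by apply/measurable_EFinP; exact: measurable_gauss_pdf.
  by rewrite diracT mul1e /gauss_pdf big_ord0 expr0 mul1r oppr0 mul0r expR0.
rewrite ge0_integral_rV_cons; last 2 first.
- by apply/measurable_EFinP; exact: measurable_gauss_pdf.
- by move=> v; rewrite lee_fin gauss_pdf_ge0.
under eq_integral => x _.
  under eq_integral => v _ do rewrite gauss_pdf_cons EFinM.
  rewrite ge0_integralZl//; last 3 first.
  - by apply/measurable_EFinP; exact: measurable_gauss_pdf.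
  - by move=> v _; rewrite lee_fin gauss_pdf_ge0.
  - by rewrite lee_fin normal_pdf_ge0.
  rewrite IH mule1; over.
exact: integral_normal_pdf.
Qed.

(** Represents a variable of law N(m, s^2 I) as [m + s *: z] with [z] standard Gaussian, so that the
    parameters move from the density into the test function. *)
Lemma ge0_integral_gauss_pdf n (m : 'rV[R]_n) s (f : 'rV[R]_n -> R) : 0 < s ->
  measurable_fun setT f -> (forall x, 0 <= f x) ->
  (\int[lebesgue_rV R n]_x (f x * gauss_pdf m s x)%:E =
   \int[lebesgue_rV R n]_z (f (m + s *: z)%R * gauss_pdf 0 1 z)%:E)%E.
Proof.
move=> s0 mf f0.
have mfg : measurable_fun setT (fun x => f x * gauss_pdf m s x).
  by apply: measurable_funM => //; exact: measurable_gauss_pdf.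
have fg0 x : 0 <= f x * gauss_pdf m s x by rewrite mulr_ge0// gauss_pdf_ge0.
rewrite (@ge0_integral_rV_affine _ _ _ m s)//; last first.
  exact/measurable_EFinP.
rewrite -ge0_integralZl//; last 3 first.
- apply/measurable_EFinP; exact: (measurableT_comp mfg (measurable_rV_affine m s)).
- by move=> z _; rewrite lee_fin.
- by rewrite lee_fin exprn_ge0// ltW.
by apply: eq_integral => z _; rewrite -EFinM mulrCA gauss_pdf_affine.
Qed.

End standard_gaussian.

Lemma density_integrable (R : realType) d (q : 'rV[R]_d -> R) : is_density q ->
  (lebesgue_rV R d).-integrable setT (EFin \o q).
Proof.
move=> [mq q0 iq]; apply/integrableP; split; first exact/measurable_EFinP.
by under eq_integral do rewrite /= ger0_norm//; rewrite iq ltry.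
Qed.

(** * Weak convergence of Gaussian mollifications *)

Lemma is_density_gauss_pdf01 (R : realType) d :
  is_density (gauss_pdf 0 1 : 'rV[R]_d -> R).
Proof.
split; [exact: measurable_gauss_pdf|exact: gauss_pdf_ge0|].
exact: integral_gauss_pdf01.
Qed.

(** If [|f| <= M], then [f + M] lies between 0 and [2 * M], and the integral of [f] is the
    difference of those of [f + M] and of the constant [M]. Nonnegative test functions are the ones
    to which Tonelli applies. *)
Lemma weakly_converges_ge0 (R : realType) d (F : set_system R) {FF : Filter F}
    (p : R -> 'rV[R]_d -> R) (q : 'rV[R]_d -> R) :
  (\forall s \near F, is_density (p s)) -> is_density q ->
  (forall (f : 'rV[R]_d -> R) (M : R), continuous f ->
    (forall x, 0 <= f x <= M) ->
    \int[lebesgue_rV R d]_x (f x * p s x) @[s --> F] -->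
    \int[lebesgue_rV R d]_x (f x * q x)) ->
  weakly_converges F p q.
Proof.
move=> pF dq H f cf [M fM].
have fMM x : 0 <= f x + M <= 2 * M by have := fM x; rewrite ler_norml; lra.
have M0 : 0 <= M := le_trans (normr_ge0 _) (fM 0).
have cfM : continuous (fun x => f x + M).
  move=> x; apply: (@cvgD _ _ _ (nbhs x) _ f (cst M)); first exact: cf.
  exact: cvg_cst.
have E r : is_density r -> \int[lebesgue_rV R d]_x (f x * r x) =
    \int[lebesgue_rV R d]_x ((f x + M) * r x) -
    \int[lebesgue_rV R d]_x (cst M x * r x).
  move=> dr; have ir := density_integrable dr.
  have [mr r0 _] := dr.
  have I1 : (lebesgue_rV R d).-integrable setT
      (EFin \o (fun x => (f x + M) * r x)).
    apply: (@le_integrable_EFin _ _ _ _ _ (fun x => 2 * M * r x)).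
    - by apply: measurable_funM => //; exact: continuous_measurable_rV.
    - move=> x; have /andP[f1 f2] := fMM x.
      by rewrite ger0_norm ?mulr_ge0// ler_wpM2r.
    - exact: integrable_EFinZl.
  rewrite -RintegralB//; last exact: integrable_EFinZl.
  by apply: eq_Rintegral => x _; rewrite /cst; ring.
rewrite (E q dq).
apply: cvg_trans (cvgB (H _ _ cfM fMM) (H (cst M) M _ _)); last 2 first.
- exact: cst_continuous.
- by move=> x /=; rewrite M0 lexx.
apply: near_eq_cvg.
near=> s; rewrite /= [in RHS]E//.
by near: s.
Unshelve. all: by end_near. Qed.

Section mollification.
Variables (R : realType) (d : nat).
Implicit Types (f : 'rV[R]_d -> R) (a s M : R) (y z : 'rV[R]_d).

(** This is E[f(a y + s Z)] with Z standard Gaussian. Unlike the density of a y + s Z, it makes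
    sense at [s = 0], the value reached at t = 1. *)
Definition mollify f a s y : R :=
  \int[lebesgue_rV R d]_z (f (a *: y + s *: z) * gauss_pdf 0 1 z).

Lemma measurable_lincomb a s : measurable_fun setT
  (fun yz : 'rV[R]_d * 'rV[R]_d => a *: yz.1 + s *: yz.2).
Proof.
apply/measurable_fun_rVP => i.
rewrite (_ : _ \o _ = (fun yz : 'rV[R]_d * 'rV[R]_d =>
    a * rV_coord i yz.1 + s * rV_coord i yz.2)); last first.
  by apply/funext => v; rewrite /rV_coord /= !mxE.
apply: measurable_funD; apply: measurable_funM; try exact: measurable_cst.
  exact: (measurableT_comp (measurable_rV_coord i) measurable_fst).
exact: (measurableT_comp (measurable_rV_coord i) measurable_snd).
Qed.

Variables (f : 'rV[R]_d -> R) (M : R).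
Hypothesis cf : continuous f.
Hypothesis f_bound : forall x, 0 <= f x <= M.

Let f0 x : 0 <= f x. Proof. by have /andP[] := f_bound x. Qed.
Let fM x : f x <= M. Proof. by have /andP[] := f_bound x. Qed.
Let mf : measurable_fun setT f. Proof. exact: continuous_measurable_rV. Qed.

Let mfg a s : measurable_fun setT (fun yz : 'rV[R]_d * 'rV[R]_d =>
  f (a *: yz.1 + s *: yz.2) * gauss_pdf 0 1 yz.2).
Proof.
apply: measurable_funM.
  exact: (measurableT_comp mf (measurable_lincomb a s)).
exact: (measurableT_comp (measurable_gauss_pdf 0 1) measurable_snd).
Qed.

Let mfg_pair a s y :
  measurable_fun setT (fun z => f (a *: y + s *: z) * gauss_pdf 0 1 z).
Proof. exact: (measurableT_comp (mfg a s) (measurable_pair1 y)). Qed.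

Let gauss_int : (lebesgue_rV R d).-integrable setT (EFin \o gauss_pdf 0 1).
Proof. exact: density_integrable (is_density_gauss_pdf01 R d). Qed.

Let fg_le a s y z :
  `|f (a *: y + s *: z) * gauss_pdf 0 1 z| <= M * gauss_pdf 0 1 z.
Proof.
have g0 := gauss_pdf_ge0 0 1 z.
by rewrite ger0_norm; [exact: ler_wpM2r|exact: mulr_ge0].
Qed.

Lemma mollifyE a s y : (mollify f a s y)%:E =
  (\int[lebesgue_rV R d]_z (f (a *: y + s *: z)%R * gauss_pdf 0 1 z)%:E)%E.
Proof.
rewrite /mollify /Rintegral fineK//; apply: integrable_fin_num => //.
apply: (le_integrable_EFin (mfg_pair a s y) (fg_le a s y)).
exact: integrable_EFinZl.
Qed.

Lemma mollify_bound a s y : 0 <= mollify f a s y <= M.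
Proof.
apply/andP; split.
  by apply: Rintegral_ge0 => z _; rewrite mulr_ge0// gauss_pdf_ge0.
rewrite -lee_fin mollifyE.
rewrite [leRHS](_ : _ = \int[lebesgue_rV R d]_z (M * gauss_pdf 0 1 z)%:E)%E.
  apply: ge0_le_integral => //.
  - by move=> z _; rewrite lee_fin mulr_ge0// gauss_pdf_ge0.
  - by apply/measurable_EFinP; exact: mfg_pair.
  - apply/measurable_EFinP; apply: measurable_funM => //.
    exact: measurable_gauss_pdf.
  - by move=> z _; rewrite lee_fin ler_wpM2r// gauss_pdf_ge0.
under eq_integral do rewrite EFinM.
rewrite ge0_integralZl//.
- by rewrite integral_gauss_pdf01 mule1.
- by apply/measurable_EFinP; exact: measurable_gauss_pdf.
- by move=> z _; rewrite lee_fin gauss_pdf_ge0.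
- by rewrite lee_fin (le_trans (f0 0)).
Qed.

Lemma measurable_mollify a s : measurable_fun setT (mollify f a s).
Proof.
apply/measurable_EFinP; rewrite (_ : _ \o _ =
    fubini_F (lebesgue_rV R d) (fun yz : 'rV[R]_d * 'rV[R]_d =>
      (f (a *: yz.1 + s *: yz.2) * gauss_pdf 0 1 yz.2)%:E)); last first.
  by apply/funext => y; rewrite /= mollifyE.
apply: measurable_fun_fubini_tonelli_F; first exact/measurable_EFinP.
by move=> yz; rewrite lee_fin mulr_ge0// gauss_pdf_ge0.
Qed.

Lemma mollify01 y : mollify f 0 1 y =
  \int[lebesgue_rV R d]_z (f z * gauss_pdf 0 1 z).
Proof. by apply: eq_Rintegral => z _; rewrite scale0r add0r scale1r. Qed.

Lemma Rintegral_gauss_pdf01 :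
  \int[lebesgue_rV R d]_z (gauss_pdf 0 1 z) = 1 :> R.
Proof. by rewrite /Rintegral integral_gauss_pdf01. Qed.

Lemma mollify10 y : mollify f 1 0 y = f y.
Proof.
rewrite /mollify.
under eq_Rintegral do rewrite scale0r addr0 scale1r.
by rewrite RintegralZl// Rintegral_gauss_pdf01 mulr1.
Qed.

(** The integrands converge pointwise by continuity of [f] and are dominated by [M] times the
    Gaussian density; a limit [s = 0] is allowed. *)
Lemma mollify_cvg (a_ s_ : nat -> R) a s y :
  a_ n @[n --> \oo] --> a -> s_ n @[n --> \oo] --> s ->
  mollify f (a_ n) (s_ n) y @[n --> \oo] --> mollify f a s y.
Proof.
move=> a_a s_s; apply: (@dominated_cvg_Rintegral _ _ _ _
  (fun n z => f (a_ n *: y + s_ n *: z) * gauss_pdf 0 1 z) _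
  (fun z => M * gauss_pdf 0 1 z)) => //.
- move=> z; apply: cvgM; last exact: cvg_cst.
  apply: (cvg_comp _ f); last exact: cf.
  by apply: cvgD; apply: cvgZ => //; exact: cvg_cst.
- exact: integrable_EFinZl.
Qed.

Lemma Rintegral_mollify_cvg (q : 'rV[R]_d -> R) (a_ s_ : nat -> R) a s :
  is_density q ->
  a_ n @[n --> \oo] --> a -> s_ n @[n --> \oo] --> s ->
  \int[lebesgue_rV R d]_y (mollify f (a_ n) (s_ n) y * q y) @[n --> \oo] -->
  \int[lebesgue_rV R d]_y (mollify f a s y * q y).
Proof.
move=> dq a_a s_s; have [mq q0 _] := dq; have iq := density_integrable dq.
apply: (@dominated_cvg_Rintegral _ _ _ _
  (fun n y => mollify f (a_ n) (s_ n) y * q y) _ (fun y => M * q y)).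
- by move=> n; apply: measurable_funM => //; exact: measurable_mollify.
- by move=> y; apply: cvgM; [exact: mollify_cvg|exact: cvg_cst].
- exact: integrable_EFinZl.
- move=> n y; have /andP[m0 mM] := mollify_bound (a_ n) (s_ n) y.
  by rewrite ger0_norm; [exact: ler_wpM2r|exact: mulr_ge0].
Qed.

End mollification.

(** * Moments of p1 against Gaussian kernels *)

Section gauss_bounds.
Variables (R : realType) (d : nat).
Implicit Types (X : 'I_d -> R) (b : R) (y : 'rV[R]_d).

Definition sqdist X b y : R := \sum_(i < d) (X i - b * y ord0 i) ^+ 2.

(** The unnormalized kernel in rescaled variables; [X] is a family of scalars so that its
    coordinates can be differentiated one by one. *)
Definition gauss X b y : R := expR (- (sqdist X b y / 2)).

Definition norm1 y : R := \sum_(i < d) `|y ord0 i|.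

Lemma sqdist_ge0 X b y : 0 <= sqdist X b y.
Proof. by apply: sumr_ge0 => i _; exact: sqr_ge0. Qed.

Lemma gauss_ge0 X b y : 0 <= gauss X b y. Proof. exact: expR_ge0. Qed.

Lemma norm1_ge0 y : 0 <= norm1 y.
Proof. by apply: sumr_ge0. Qed.

Lemma le_norm1 y i : `|y ord0 i| <= norm1 y.
Proof. by rewrite /norm1 (bigD1 i)//= lerDl sumr_ge0. Qed.

(** Since [b] is bounded below, [1 + norm1 y] is at most a constant times [1 + sqdist X b y], and
    the exponential beats any power of that. The cube is what the Lipschitz estimate needs: one
    power for the weight, two for the increment of the exponent. *)
Lemma norm1_gauss_le (M b0 : R) : 0 <= M -> 0 < b0 ->
  exists2 C, 0 <= C & forall X b y, (forall i, `|X i| <= M) -> b0 <= b ->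
    (1 + norm1 y) ^+ 3 * gauss X b y <= C.
Proof.
move=> M0 b00.
(* Comes from summing [|y_i| <= (M + 1 + (X_i - b y_i)^2) / b0] over the coordinates, itself a
   consequence of [|z| <= 1 + z^2]. *)
pose C0 := 1 + (d%:R * (M + 1) + 1) / b0.
have C01 : 1 <= C0.
  by rewrite lerDl divr_ge0 ?(ltW b00)// addr_ge0// mulr_ge0// addr_ge0.
exists ((6 * C0) ^+ 3) => [|X b y XM bb0].
  by rewrite exprn_ge0// mulr_ge0// (le_trans _ C01).
have yle i : `|y ord0 i| <= (M + 1 + (X i - b * y ord0 i) ^+ 2) / b0.
  rewrite ler_pdivlMr//.
  have by0 : `|b * y ord0 i| <= M + `|X i - b * y ord0 i|.
    rewrite -[X in `|X|](subKr (X i)) (le_trans (ler_normB _ _))// lerD2r.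
    exact: XM.
  have bE : `|y ord0 i| * b0 <= `|b * y ord0 i|.
    by rewrite normrM mulrC ler_wpM2r// (le_trans bb0)// ler_norm.
  rewrite (le_trans bE)// (le_trans by0)// -addrA lerD2l.
  rewrite -real_normK ?num_real//.
  by have := sqr_ge0 (`|X i - b * y ord0 i| - 1); nra.
have SQ : 1 + norm1 y <= C0 * (1 + sqdist X b y).
  have : norm1 y <= (d%:R * (M + 1) + sqdist X b y) / b0.
    rewrite (le_trans (ler_sum _ (fun i _ => yle i)))//.
    rewrite -mulr_suml big_split/= sumr_const card_ord.
    by rewrite mulr_natl lexx.
  have Q0 := sqdist_ge0 X b y.
  set Q := sqdist X b y in Q0 *; set S := norm1 y.
  have b0V : 0 < b0^-1 by rewrite invr_gt0.
  rewrite /C0; set D := d%:R * (M + 1).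
  have D0 : 0 <= D by rewrite mulr_ge0// addr_ge0.
  move: b0V; set c := b0^-1 => c0 H.
  have := mulr_ge0 D0 (mulr_ge0 (ltW c0) Q0).
  have := mulr_ge0 (ltW c0) Q0.
  nra.
rewrite /gauss; set Q := sqdist X b y in SQ *.
have Q0 : 0 <= Q by exact: sqdist_ge0.
(* Splitting the exponential into three equal factors reduces the cube to a linear bound, which
   follows from [1 + Q <= 6 * expR (Q / 6)]. *)
have -> : expR (- (Q / 2)) = (expR (- (Q / 6))) ^+ 3.
  by rewrite -expRM_natr; congr expR; field.
have C0_ge0 : 0 <= C0 by exact: le_trans C01.
have S0 : 0 <= 1 + norm1 y by rewrite addr_ge0// norm1_ge0.
rewrite -exprMn; apply: lerXn2r; rewrite ?nnegrE ?mulr_ge0 ?expR_ge0//.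
rewrite expRN ler_pdivrMr ?expR_gt0//.
rewrite (le_trans SQ)// (mulrC 6) -mulrA ler_wpM2l//.
have := expR_ge1Dx (Q / 6); lra.
Qed.

(** For [u <= v], [expR (- v)] is at least [expR (- u) * (1 + u - v)]. The exponentials are kept on
    the right so that they can absorb the growth in [y] of the difference of the exponents. *)
Lemma expRN_lipschitz (u v : R) :
  `|expR (- u) - expR (- v)| <= `|u - v| * (expR (- u) + expR (- v)).
Proof.
wlog uv : u v / u <= v.
  move=> H; have [|/ltW] := leP u v; first exact: H.
  by rewrite distrC (distrC u) (addrC (expR (- u))); exact: H.
rewrite ger0_norm ?subr_ge0 ?ler_expR ?lerN2// distrC ger0_norm ?subr_ge0//.
have uE : expR (- v) = expR (- u) * expR (u - v).
  by rewrite -expRD; congr expR; ring.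
have := expR_ge1Dx (u - v).
have := expR_gt0 (- u).
have := expR_gt0 (- v).
rewrite [X in _ -> _ -> _ -> _ - X <= _]uE; nra.
Qed.

(** The exponents differ by at most a constant times [delta * (1 + norm1 y) ^+ 2]; with the weight
    this makes a third power, which either kernel absorbs. *)
Lemma gauss_lipschitz (M b0 b1 : R) : 0 <= M -> 0 < b0 -> 0 <= b1 ->
  exists2 C, 0 <= C & forall X X' b b' (delta : R) y,
    (forall i, `|X i| <= M) -> (forall i, `|X' i| <= M) ->
    b0 <= b -> b <= b1 -> b0 <= b' -> b' <= b1 ->
    (forall i, `|X i - X' i| <= delta) -> `|b - b'| <= delta ->
    (1 + norm1 y) * `|gauss X b y - gauss X' b' y| <= C * delta.
Proof.
move=> M0 b00 b10; have [C C0 CP] := norm1_gauss_le M0 b00.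
exists (d%:R * (M + b1) * (2 * C)) =>
  [|X X' b b' delta y XM X'M bl bu bl' bu' XX' bb'].
  by rewrite !mulr_ge0// addr_ge0.
have S0 := norm1_ge0 y.
have dl0 : 0 <= delta by rewrite (le_trans _ bb').
have QQ : `|sqdist X b y - sqdist X' b' y| <=
    d%:R * (M + b1) * 2 * delta * (1 + norm1 y) ^+ 2.
  rewrite -sumrB (le_trans (ler_norm_sum _ _ _))//.
  have H i : `|(X i - b * y ord0 i) ^+ 2 - (X' i - b' * y ord0 i) ^+ 2| <=
     (M + b1) * 2 * delta * (1 + norm1 y) ^+ 2.
    (* In the difference of squares one factor carries [delta], and both grow linearly in [y]. *)
    rewrite subr_sqr normrM.
    have yS := le_norm1 y i.
    have -> : X i - b * y ord0 i - (X' i - b' * y ord0 i) =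
       (X i - X' i) - (b - b') * y ord0 i by ring.
    have H1 : `|(X i - X' i) - (b - b') * y ord0 i| <= delta * (1 + norm1 y).
      rewrite (le_trans (ler_normB _ _))// mulrDr mulr1 lerD// normrM.
      by rewrite ler_pM.
    have u1 (Z : 'I_d -> R) c : `|Z i| <= M -> b0 <= c -> c <= b1 ->
        `|Z i - c * y ord0 i| <= (M + b1) * (1 + norm1 y).
      move=> ZM cb0 cb1; rewrite (le_trans (ler_normB _ _))// normrM.
      rewrite ger0_norm; last by rewrite (le_trans (ltW b00)).
      have : c * `|y ord0 i| <= b1 * norm1 y.
        by rewrite ler_pM// (le_trans (ltW b00)).
      have := mulr_ge0 M0 S0; nra.
    have H2 : `|X i - b * y ord0 i + (X' i - b' * y ord0 i)| <=
        2 * ((M + b1) * (1 + norm1 y)).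
      rewrite (le_trans (ler_normD _ _))// mulr_natl mulr2n lerD//; exact: u1.
    apply: le_trans (ler_pM _ _ H1 H2) _; rewrite //.
    by rewrite le_eqVlt; apply/orP; left; apply/eqP; ring.
  rewrite (le_trans (ler_sum _ (fun i _ => H i)))//.
  by rewrite sumr_const card_ord -[leLHS](mulr_natl _ d) !mulrA lexx.
have EE := expRN_lipschitz (sqdist X b y / 2) (sqdist X' b' y / 2).
rewrite -/(gauss X b y) -/(gauss X' b' y) -mulrBl normrM in EE.
rewrite (ger0_norm (_ : 0 <= 2^-1)) ?invr_ge0// in EE.
have G1 := CP X b y XM bl; have G2 := CP X' b' y X'M bl'.
have g1 := gauss_ge0 X b y; have g2 := gauss_ge0 X' b' y.
set S := norm1 y in S0 QQ G1 G2 *.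
set D := d%:R * (M + b1) in QQ *.
have D0 : 0 <= D by rewrite mulr_ge0// addr_ge0.
move: QQ EE; set q := `|_ - _| => QQ; set e := `|_ - _| => EE.
apply: (@le_trans _ _ ((1 + S) * ((D * 2 * delta * (1 + S) ^+ 2) / 2 *
    (gauss X b y + gauss X' b' y)))).
  rewrite ler_wpM2l ?addr_ge0// (le_trans EE)//.
  by rewrite ler_wpM2r ?addr_ge0// ler_wpM2r ?invr_ge0.
have -> : (1 + S) * (D * 2 * delta * (1 + S) ^+ 2 / 2 *
    (gauss X b y + gauss X' b' y)) =
  D * delta * ((1 + S) ^+ 3 * gauss X b y + (1 + S) ^+ 3 * gauss X' b' y).
  by field.
have -> : D * (2 * C) * delta = D * delta * (C + C) by ring.
apply: ler_wpM2l; first exact: mulr_ge0.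
exact: lerD.
Qed.

End gauss_bounds.

(** * Integrability and differentiation of the moments *)

Section gauss_moments.
Variables (R : realType) (d : nat) (p : 'rV[R]_d -> R).
Hypothesis p_ge0 : forall y, 0 <= p y.
Hypothesis p_int : (lebesgue_rV R d).-integrable setT (EFin \o p).
Implicit Types (X : 'I_d -> R) (b : R) (w : 'rV[R]_d -> R).

Lemma measurable_sqdist X b : measurable_fun setT (@sqdist R d X b).
Proof.
apply: measurable_sum => i; apply: measurable_funX.
apply: measurable_funB; first exact: measurable_cst.
by apply: measurable_funM; [exact: measurable_cst|exact: measurable_rV_coord].
Qed.

Lemma measurable_gauss X b : measurable_fun setT (@gauss R d X b).
Proof.
apply: measurableT_comp => //; apply: measurableT_comp => //.
by apply: measurable_funM; [exact: measurable_sqdist|exact: measurable_cst].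
Qed.

Let mp : measurable_fun setT p.
Proof. by have /integrableP[/measurable_EFinP] := p_int. Qed.

Definition moment X b w : R :=
  \int[lebesgue_rV R d]_y (w y * (gauss X b y * p y)).

(** The kernel absorbs the cubic growth of the weight, so the integrand is dominated by a multiple
    of [p]. *)
Lemma integrable_moment X b w (k : R) : 0 < b -> measurable_fun setT w ->
  (forall y, `|w y| <= k * (1 + norm1 y) ^+ 3) ->
  (lebesgue_rV R d).-integrable setT
    (EFin \o (fun y => w y * (gauss X b y * p y))).
Proof.
move=> b0 mw wk.
have M0 : 0 <= \sum_i `|X i| by apply: sumr_ge0.
have [C C0 CP] := @norm1_gauss_le R d _ _ M0 b0.
apply: (@le_integrable_EFin _ _ _ _ _ (fun y => (k * C) * p y)); last 2 first.
- move=> y; rewrite normrM (ger0_norm (mulr_ge0 (gauss_ge0 _ _ _) (p_ge0 _))).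
  rewrite mulrA ler_wpM2r//.
  rewrite (le_trans (ler_wpM2r (gauss_ge0 _ _ _) (wk y)))// -mulrA.
  have k0 : 0 <= k.
    have := le_trans (normr_ge0 _) (wk y).
    by rewrite pmulr_lge0// exprn_gt0// ltr_pwDl// norm1_ge0.
  rewrite ler_wpM2l// CP// => i.
  by rewrite (bigD1 i)//= lerDl sumr_ge0.
- exact: integrable_EFinZl.
- apply: measurable_funM => //; apply: measurable_funM => //.
  exact: measurable_gauss.
Qed.

Lemma is_derive_gauss (X : R -> 'I_d -> R) (b : R -> R) (a : R) X' b' y :
  (forall i, is_derive a 1 (X ^~ i) (X' i)) -> is_derive a 1 b b' ->
  is_derive a 1 (fun s => gauss (X s) (b s) y)
    (- (\sum_i (X a i - b a * y ord0 i) * (X' i - b' * y ord0 i))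
     * gauss (X a) (b a) y).
Proof.
move=> dX db.
have dsq : is_derive a 1 (fun s => sqdist (X s) (b s) y)
    (\sum_i (2 * (X a i - b a * y ord0 i) * (X' i - b' * y ord0 i))).
  have -> : (fun s => sqdist (X s) (b s) y) =
      \sum_i (fun s => (X s i - b s * y ord0 i) ^+ 2).
    by apply/funext => s; rewrite fct_sumE.
  apply: is_derive_sum => i.
  have dby : is_derive a 1 (fun s => b s * y ord0 i) (b' * y ord0 i).
    have := is_deriveM db (is_derive_cst (y ord0 i) a 1).
    by move/is_derive_eq; apply; rewrite scaler0 add0r [LHS]mulrC.
  have := is_deriveX 2 (is_deriveB (dX i) dby).
  by move/is_derive_eq; apply; rewrite expr1.
have dh : is_derive a 1 (fun s => - (sqdist (X s) (b s) y / 2))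
   (- (\sum_i (X a i - b a * y ord0 i) * (X' i - b' * y ord0 i))).
  have := is_deriveN (is_deriveM dsq (is_derive_cst (2^-1 : R) a 1)).
  move/is_derive_eq; apply; rewrite scaler0 add0r; congr -%R.
  rewrite [LHS]mulr_sumr; apply: eq_bigr => i _.
  by rewrite /cst; field.
have := is_derive1_comp (is_derive_expR _) dh.
by move/is_derive_eq; apply; rewrite mulrC.
Qed.

(** Stated along an arbitrary path [(X, b)] so as to serve both for the time derivative and for the
    partial derivatives in x. The dominating function [C * L1 * p] composes the Lipschitz bound of
    the kernel, uniform in [y], with those of the path at [a]. *)
Lemma is_derive_moment (X : R -> 'I_d -> R) (b : R -> R) (a : R) X' b' w :
  (forall i, is_derive a 1 (X ^~ i) (X' i)) -> is_derive a 1 b b' ->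
  0 < b a -> measurable_fun setT w -> (forall y, `|w y| <= 1 + norm1 y) ->
  is_derive a 1 (fun s => moment (X s) (b s) w)
    (moment (X a) (b a) (fun y =>
      - w y * \sum_i (X a i - b a * y ord0 i) * (X' i - b' * y ord0 i))).
Proof.
move=> dX db ba0 mw wS.
(* The added 1 leaves room for [X x] to stay bounded by [M] near [a]; likewise [b] stays between
   [b a / 2] and [2 * b a], away from 0. *)
pose M := 1 + \sum_i `|X a i|.
have M0 : 0 <= M by rewrite addr_ge0// sumr_ge0.
have b20 : 0 < b a / 2 by rewrite divr_gt0.
have b2 : 0 <= 2 * b a by rewrite mulr_ge0// ltW.
have [C C0 CP] := @gauss_lipschitz R d _ _ _ M0 b20 b2.
have /choice[L LP] i : exists L, 0 < L /\
    \forall x \near a, `|X x i - X a i| <= L * `|x - a|.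
  have [dXi _] := dX i.
  by have [L L0 LP] := derivable_lipschitz_at dXi; exists L.
have [dbb _] := db.
have [Lb Lb0 LbP] := derivable_lipschitz_at dbb.
pose L1 := \sum_i L i + Lb.
have L_ge0 i : 0 <= L i by apply: ltW; case: (LP i).
have LL1 i : L i <= L1.
  by rewrite /L1 (bigD1 i)//= -addrA lerDl addr_ge0 ?(ltW Lb0)// sumr_ge0.
have LbL1 : Lb <= L1 by rewrite lerDr sumr_ge0.
have wS3 y : `|w y| <= 1 * (1 + norm1 y) ^+ 3.
  rewrite mul1r (le_trans (wS y))// ler_eXnr// lerDl; exact: norm1_ge0.
have b_cont : b x @[x --> a] --> b a.
  exact: derivable_continuous_at.
have X_cont i : X x i @[x --> a] --> X a i.
  have [dXi _] := dX i.
  exact: (@derivable_continuous_at _ (X ^~ i)).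
have b_lo : \forall x \near a, b a / 2 < b x.
  by apply: (cvgr_gt _ b_cont); lra.
have b_hi : \forall x \near a, b x < 2 * b a.
  by apply: (cvgr_lt _ b_cont); lra.
have X_le : \forall x \near a, forall i, `|X x i| < M.
  suff H i : \forall x \near a, `|X x i| < M.
    exact: (@filter_forall R _ (fun i x => `|X x i| < M) (nbhs a) _ H).
  apply: (cvgr_lt _ (cvg_norm (X_cont i))).
  by rewrite /M (bigD1 i)//= addrCA ltrDl ltr_pwDl// sumr_ge0.
have X_lip : \forall x \near a, forall i, `|X x i - X a i| <= L1 * `|x - a|.
  suff H i : \forall x \near a, `|X x i - X a i| <= L1 * `|x - a|.
    exact: (@filter_forall R _
      (fun i x => `|X x i - X a i| <= L1 * `|x - a|) (nbhs a) _ H).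
  have [_] := LP i.
  by apply: filterS => x /le_trans; apply; rewrite ler_wpM2r.
have XaM i : `|X a i| <= M.
  by rewrite /M (bigD1 i)//= addrCA lerDl addr_ge0// sumr_ge0.
apply: is_derive_eq; first apply: (@is_derive_Rintegral _ _ _ _
  (fun s y => w y * (gauss (X s) (b s) y * p y)) a
  (fun y => w y * (- (\sum_i (X a i - b a * y ord0 i) * (X' i - b' * y ord0 i))
     * gauss (X a) (b a) y * p y)) (fun y => C * L1 * p y)).
- move=> y.
  have dg := is_derive_gauss y dX db.
  have := is_deriveM (is_derive_cst (w y) a 1)
    (is_deriveM dg (is_derive_cst (p y) a 1)).
  move/is_derive_eq; apply; rewrite !scaler0 addr0 add0r.
  by congr (_ * _); rewrite [LHS]mulrC.
- exact: integrable_EFinZl.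
- near=> x.
  have bx : b a / 2 < b x by near: x.
  split.
    apply: (@integrable_moment _ _ _ 1) => //.
    by rewrite (lt_trans b20).
  move=> y; rewrite -mulrBr -mulrBl !normrM (ger0_norm (p_ge0 y)).
  rewrite mulrA [leRHS]mulrAC ler_wpM2r//.
  apply: (@le_trans _ _ ((1 + norm1 y) *
      `|gauss (X x) (b x) y - gauss (X a) (b a) y|)).
    by rewrite ler_wpM2r.
  rewrite -mulrA; apply: CP => //.
  + by move=> i; apply: ltW; move: i; near: x.
  + exact: ltW.
  + by apply: ltW; near: x.
  + lra.
  + lra.
  + by near: x.
  + apply: (@le_trans _ _ (Lb * `|x - a|)); first by near: x.
    by rewrite ler_wpM2r.
- apply: eq_Rintegral => y _; ring.
Unshelve. all: by end_near. Qed.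

End gauss_moments.

(** * Quadratic weights and positivity of the zeroth moment *)

Section moment_algebra.
Variables (R : realType) (d : nat) (p : 'rV[R]_d -> R).
Hypothesis p_ge0 : forall y, 0 <= p y.
Hypothesis p_int : (lebesgue_rV R d).-integrable setT (EFin \o p).
Variables (X : 'I_d -> R) (b : R).
Hypothesis b0 : 0 < b.

Let moment1 := moment p X b (cst 1).
Let momentX i := moment p X b (fun y => y ord0 i).
Let momentX2 i := moment p X b (fun y => y ord0 i ^+ 2).

Lemma exp_coord_le (i : 'I_d) (y : 'rV[R]_d) k : (k <= 3)%N ->
  `|y ord0 i ^+ k| <= 1 * (1 + norm1 y) ^+ 3.
Proof.
move=> k3; have yS := le_norm1 y i; have S0 := norm1_ge0 y.
rewrite mul1r normrX (@le_trans _ _ ((1 + norm1 y) ^+ k))//.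
  by apply: lerXn2r; rewrite ?nnegrE ?addr_ge0// (le_trans yS)// lerDr.
by apply: ler_weXn2l; rewrite ?lerDl.
Qed.

Lemma integrable_momentX i k : (k <= 3)%N ->
  (lebesgue_rV R d).-integrable setT
    (EFin \o (fun y : 'rV[R]_d => y ord0 i ^+ k * (gauss X b y * p y))).
Proof.
move=> k3; apply: (@integrable_moment _ _ _ _ _ _ _ _ 1) => //.
  by apply: measurable_funX; exact: measurable_rV_coord.
by move=> y; exact: exp_coord_le.
Qed.

(** Every weight produced by the derivatives is a sum of quadratic polynomials in single
    coordinates. Integrability accompanies the value for the later summation over [i]. *)
Lemma moment_quadratic (c0 c1 c2 : R) i :
  (lebesgue_rV R d).-integrable setT (EFin \o (fun y : 'rV[R]_d =>
    (c0 + c1 * y ord0 i + c2 * y ord0 i ^+ 2) * (gauss X b y * p y))) /\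
  moment p X b (fun y => c0 + c1 * y ord0 i + c2 * y ord0 i ^+ 2) =
  c0 * moment1 + c1 * momentX i + c2 * momentX2 i.
Proof.
have I0 := integrable_momentX i (isT : 0 <= 3)%N.
have I1 := integrable_momentX i (isT : 1 <= 3)%N.
have I2 := integrable_momentX i (isT : 2 <= 3)%N.
have J0 := integrable_EFinZl c0 I0.
have J1 := integrable_EFinZl c1 I1.
have J2 := integrable_EFinZl c2 I2.
have J01 := integrable_EFinD J0 J1.
have E (y : 'rV[R]_d) : (c0 + c1 * y ord0 i + c2 * y ord0 i ^+ 2) *
    (gauss X b y * p y) = (c0 * (y ord0 i ^+ 0 * (gauss X b y * p y)) +
    c1 * (y ord0 i ^+ 1 * (gauss X b y * p y))) +
    c2 * (y ord0 i ^+ 2 * (gauss X b y * p y)) by ring.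
split; first by rewrite (funext E); exact: integrable_EFinD J01 J2.
rewrite /moment (eq_Rintegral _ (fun y _ => E y)).
rewrite (RintegralD measurableT J01 J2) (RintegralD measurableT J0 J1).
rewrite (RintegralZl _ measurableT I0) (RintegralZl _ measurableT I1).
by rewrite (RintegralZl _ measurableT I2).
Qed.

Lemma moment_sum_quadratic (c0 c1 c2 : 'I_d -> R) :
  moment p X b
    (fun y => \sum_i (c0 i + c1 i * y ord0 i + c2 i * y ord0 i ^+ 2)) =
  \sum_i (c0 i * moment1 + c1 i * momentX i + c2 i * momentX2 i).
Proof.
have [_ H] := Rintegral_sum (index_enum 'I_d) (fun i =>
  (moment_quadratic (c0 i) (c1 i) (c2 i) i).1).
rewrite /moment; under eq_Rintegral do rewrite mulr_suml.
rewrite H; apply: eq_bigr => i _.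
by rewrite -(moment_quadratic _ _ _ _).2.
Qed.

(** Were it zero, the nonnegative integrand would vanish almost everywhere, and so would [p], the
    kernel being positive; this contradicts the positive mass of [p]. *)
Lemma moment1_gt0 : (0 < \int[lebesgue_rV R d]_y (p y)%:E)%E -> 0 < moment1.
Proof.
move=> p_pos.
have m1_ge0 : 0 <= moment1.
  apply: Rintegral_ge0 => y _.
  by rewrite !mulr_ge0// gauss_ge0.
rewrite lt_neqAle m1_ge0 andbT eq_sym; apply/negP => /eqP m10.
pose g y := gauss X b y * p y.
have Ig : (lebesgue_rV R d).-integrable setT (EFin \o g).
  have -> : g = (fun y => 1 * (gauss X b y * p y)).
    by apply/funext => y; rewrite mul1r.
  apply: (@integrable_moment _ _ _ _ _ _ _ (cst 1) 1) => // y.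
  by rewrite normr1 mul1r exprn_ege1// lerDl norm1_ge0.
have mg : measurable_fun setT (EFin \o g).
  by case/integrableP : Ig.
have : (\int[lebesgue_rV R d]_y `|(EFin \o g) y| = 0)%E.
  have -> : (\int[lebesgue_rV R d]_y `|(EFin \o g) y| =
     \int[lebesgue_rV R d]_y (EFin \o g) y)%E.
    apply: eq_integral => y _ /=.
    by rewrite ger0_norm// mulr_ge0// gauss_ge0.
  rewrite -[LHS]fineK; last exact: integrable_fin_num.
  rewrite -[RHS]/((0 : R)%:E); congr EFin; rewrite -[RHS]m10 /moment1 /moment.
  by apply: eq_Rintegral => y _; rewrite /= mul1r.
move/(ae_eq_integral_abs _ measurableT mg) => p_ae.
have : (\int[lebesgue_rV R d]_y (p y)%:E = \int[lebesgue_rV R d]_y (cst 0 y))%E.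
  apply: ae_eq_integral => //; first by case/integrableP : p_int.
  apply: filterS p_ae => y /= /(_ I) [] /eqP.
  by rewrite mulf_eq0 gt_eqF ?expR_gt0//= => /eqP -> _.
by rewrite integral0 => p0; rewrite p0 ltxx in p_pos.
Qed.

End moment_algebra.

(** * The continuity equation *)

(** Reduces a directional derivative to one in a real parameter, the setting in which the moments
    are differentiated. *)
Lemma is_derive_line (R : numFieldType) (V W : normedModType R) (f : V -> W)
    (x v : V) (l : W) :
  is_derive (0 : R) 1 (fun h : R => f (h *: v + x)) l -> is_derive x v f l.
Proof.
move=> [dg gE]; split; first exact/derivable1P.
rewrite -gE /derive; apply: (f_equal (fun g : R -> W => lim (g @ 0^'))).
by apply/funext => h; rewrite /= addr0 scale0r add0r [_%:A]mulr1.
Qed.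

Lemma near_in_oo01 (R : realType) (t : R) :
  0 < t < 1 -> \forall s \near t, 0 < s < 1.
Proof.
move=> t01; have : t \in `]0, 1[ by rewrite in_itv.
move/near_in_itvoo => H; near=> s.
have : s \in `]0, 1[ by near: s.
by rewrite in_itv.
Unshelve. all: by end_near.
Qed.

(** At an interior point small increments never leave the interval, so the restricted limit is the
    two-sided one. *)
Lemma differentiable_within_derivable (R : realType) (f : R -> R) (t : R) :
  differentiable_within `[0, 1]%classic f -> 0 < t < 1 -> derivable f t 1.
Proof.
move=> df t01.
have /cvg_ex[/= l] :
    cvg ((f s - f t) / (s - t) @[s --> within `[0, 1]%classic t^']).
  by apply: df => /=; rewrite in_itv/=; lra.
move=> /cvgrPdist_le fl; apply/cvg_ex; exists l; apply/cvgrPdist_le => e e0.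
have [r /= r0 H] := fl e e0.
have [r' /= r'0 H'] := near_in_oo01 t01.
exists (Num.min r r') => /=; first by rewrite lt_min r0.
move=> h /=; rewrite sub0r normrN lt_min => /andP[hr hr'] h0.
have := H (t + h).
rewrite /= opprD addrA subrr sub0r normrN => /(_ hr).
rewrite addrC -subr_eq0 addrK => /(_ h0).
have /= := H' (h + t).
rewrite opprD addrCA subrr addr0 normrN => /(_ hr') ht.
rewrite in_itv/= => {}H.
have {}H : `|l - (f (h + t) - f t) / h| <= e by apply: H; lra.
by rewrite [_ *: 1]mulr1 [_ *: _]mulrC.
Qed.

Section continuity.
Variables (R : realType) (d : nat) (alpha sigma : R -> R) (p1 : 'rV[R]_d -> R).
Hypothesis schedulesP : schedules alpha sigma.
Hypothesis p1_density : is_density p1.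
Implicit Types (t : R) (x y : 'rV[R]_d).

Let p1_ge0 y : 0 <= p1 y. Proof. by case: p1_density. Qed.

Let p1_int := density_integrable p1_density.

Let X (t : R) (x : 'rV[R]_d) (i : 'I_d) : R := x ord0 i / sigma t.
Let b (t : R) : R := alpha t / sigma t.
Let m t x w := moment p1 (X t x) (b t) w.

Lemma cond_pdfE t x y : 0 < sigma t ->
  cond_pdf alpha sigma t y x =
  normal_peak (sigma t) ^+ d * gauss (X t x) (b t) y.
Proof.
move=> s0; rewrite /cond_pdf /gauss_pdf /gauss; congr (_ * expR _).
rewrite mulNr; congr -%R; rewrite /sqdist !mulr_suml; apply: eq_bigr => i _.
rewrite mxE /X /b; field.
by rewrite gt_eqF.
Qed.

Lemma marginal_pdfE t x : 0 < sigma t -> 0 < b t ->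
  marginal_pdf alpha sigma p1 t x =
  normal_peak (sigma t) ^+ d * m t x (cst 1).
Proof.
move=> s0 b0; rewrite /marginal_pdf /m /moment -RintegralZl//; last first.
  apply: (@integrable_moment _ _ _ _ _ _ _ _ 1) => // y.
  by rewrite normr1 mul1r exprn_ege1// lerDl norm1_ge0.
by apply: eq_Rintegral => y _; rewrite cond_pdfE// mul1r mulrA.
Qed.

Let sigma_gt0 t : 0 < t < 1 -> 0 < sigma t.
Proof. by move=> ?; exact: (schedules_sigma_gt0 schedulesP). Qed.

Let alpha_gt0 t : 0 < t < 1 -> 0 < alpha t.
Proof. by move=> ?; exact: (schedules_alpha_gt0 schedulesP). Qed.

Let b_gt0 t : 0 < t < 1 -> 0 < b t.
Proof. by move=> t01; rewrite divr_gt0 ?sigma_gt0 ?alpha_gt0. Qed.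

Let peak_gt0 t : 0 < t < 1 -> 0 < normal_peak (sigma t).
Proof. by move=> t01; rewrite normal_peak_gt0// gt_eqF// sigma_gt0. Qed.

Lemma marginal_pdf_gt0 t x : 0 < t < 1 -> 0 < marginal_pdf alpha sigma p1 t x.
Proof.
move=> t01; rewrite marginal_pdfE ?sigma_gt0 ?b_gt0//.
apply: mulr_gt0; first by rewrite exprn_gt0 ?peak_gt0.
apply: moment1_gt0 => //; first exact: b_gt0.
by case: p1_density => _ _ ->.
Qed.

(* [cond_velocity t y x = A t *: y + B t *: x]. *)
Let B t : R := derive1 sigma t / sigma t.
Let A t : R := derive1 alpha t - B t * alpha t.

Let m_quadratic t x c0 c1 c2 i : 0 < t < 1 -> _ :=
  fun t01 => moment_quadratic p1_ge0 p1_int (X t x) (b_gt0 t01) c0 c1 c2 i.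

(** The null quadratic term brings the weight to the shape of [moment_quadratic]. *)
Let velocity_integrandE t x i y : 0 < t < 1 ->
  cond_velocity alpha sigma t y x ord0 i * posterior_pdf alpha sigma p1 t x y =
  (normal_peak (sigma t) ^+ d / marginal_pdf alpha sigma p1 t x) *
  ((B t * x ord0 i + A t * y ord0 i + 0 * y ord0 i ^+ 2) *
    (gauss (X t x) (b t) y * p1 y)).
Proof.
move=> t01; rewrite /cond_velocity /posterior_pdf cond_pdfE ?sigma_gt0// !mxE.
rewrite -/(B t) -/(A t); ring.
Qed.

Lemma marginals_well_definedP t x : 0 < t < 1 ->
  marginals_well_defined alpha sigma p1 t x.
Proof.
move=> t01; have s0 := sigma_gt0 t01; split.
- have E y : cond_pdf alpha sigma t y x * p1 y =
      normal_peak (sigma t) ^+ d * (cst 1 y * (gauss (X t x) (b t) y * p1 y)).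
    by rewrite cond_pdfE// mul1r mulrA.
  rewrite (_ : (fun y => _) = EFin \o (fun y => normal_peak (sigma t) ^+ d *
     (cst 1 y * (gauss (X t x) (b t) y * p1 y)))); last first.
    by apply/funext => y; rewrite /= -E.
  apply: integrable_EFinZl.
  apply: (@integrable_moment _ _ _ _ _ _ _ _ 1) => //; first exact: b_gt0.
  by move=> y; rewrite normr1 mul1r exprn_ege1// lerDl norm1_ge0.
- exact: marginal_pdf_gt0.
- move=> i; under eq_fun do rewrite velocity_integrandE//.
  apply: (@integrable_EFinZl _ _ _ _ _ (fun y => _)).
  exact: (m_quadratic x (B t * x ord0 i) (A t) 0 i t01).1.
Qed.

(** The factor [marginal_pdf] cancels the normalization of the posterior, so the flux contains no
    quotient of moments. *)
Lemma flux_coordE t x i : 0 < t < 1 ->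
  (marginal_pdf alpha sigma p1 t x *:
    marginal_velocity alpha sigma p1 t x) ord0 i =
  normal_peak (sigma t) ^+ d *
    (B t * x ord0 i * m t x (cst 1) + A t * m t x (fun y => y ord0 i)).
Proof.
move=> t01; rewrite !mxE.
under eq_Rintegral do rewrite velocity_integrandE//.
have [J1 J2] := m_quadratic x (B t * x ord0 i) (A t) 0 i t01.
rewrite RintegralZl//.
rewrite -/(moment p1 (X t x) (b t)
  (fun y => B t * x ord0 i + A t * y ord0 i + 0 * y ord0 i ^+ 2)) J2.
have := marginal_pdf_gt0 x t01; rewrite /m.
set P := marginal_pdf _ _ _ _ _ => P0; field.
by rewrite gt_eqF.
Qed.

Let dalpha t : 0 < t < 1 -> is_derive t 1 alpha (derive1 alpha t).
Proof.
move=> t01; rewrite derive1E; apply: derivableP.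
exact: differentiable_within_derivable (schedules_alpha_diff schedulesP) t01.
Qed.

Let dsigma t : 0 < t < 1 -> is_derive t 1 sigma (derive1 sigma t).
Proof.
move=> t01; rewrite derive1E; apply: derivableP.
exact: differentiable_within_derivable (schedules_sigma_diff schedulesP) t01.
Qed.

Let dsigmaV t : 0 < t < 1 ->
  is_derive t 1 (fun s => (sigma s)^-1) (- (B t / sigma t)).
Proof.
move=> t01; have s0 : sigma t != 0 by rewrite gt_eqF// sigma_gt0.
have := is_deriveV s0 (dsigma t01).
move/is_derive_eq; apply; rewrite [LHS]mulrC /B.
by field.
Qed.

(** The coefficient [A] of [y] in the velocity is sigma times the derivative of alpha / sigma: this
    ties the velocity to the motion of the kernel. *)
Let db t : 0 < t < 1 -> is_derive t 1 b (A t / sigma t).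
Proof.
move=> t01; have s0 : sigma t != 0 by rewrite gt_eqF// sigma_gt0.
have := is_deriveM (dalpha t01) (dsigmaV t01).
move/is_derive_eq; apply.
by rewrite [X in X + _ = _]mulrN [X in _ + X = _]mulrC /A /B; field.
Qed.

Lemma is_derive_peak t : 0 < t < 1 ->
  is_derive t 1 (fun s => normal_peak (sigma s) ^+ d)
    (- (d%:R * B t) * normal_peak (sigma t) ^+ d).
Proof.
move=> t01.
have E : \forall s \near t, ((fun s => normal_peak 1 / sigma s) ^+ d) s =
    normal_peak (sigma s) ^+ d.
  near=> s; have s01 : 0 < s < 1 by near: s; exact: near_in_oo01.
  by rewrite exprfctE (normal_peakE (sigma_gt0 s01)).
apply: near_eq_is_derive E _.
have H : is_derive t 1 (fun s => normal_peak 1 / sigma s)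
    (- (B t * normal_peak (sigma t))).
  have := is_deriveM (is_derive_cst (normal_peak 1 : R) t 1) (dsigmaV t01).
  move/is_derive_eq; apply; rewrite scaler0 addr0 [LHS]mulrN; congr -%R.
  by rewrite (normal_peakE (sigma_gt0 t01)) [LHS]mulrCA.
have := is_deriveX d H; move/is_derive_eq; apply.
rewrite -(normal_peakE (sigma_gt0 t01)).
(* The power rule leaves the exponent [d.-1], which recombines into [d] only for positive [d]; in
   dimension 0 both sides vanish. *)
case: d => [|n]; first by rewrite !mul0r oppr0 mul0r scale0r.
by rewrite [LHS]mulrN mulNr exprS; congr -%R; rewrite /=; ring.
Unshelve. all: by end_near. Qed.

Lemma is_derive_marginal_pdf t x : 0 < t < 1 ->
  is_derive t 1 (fun s => marginal_pdf alpha sigma p1 s x)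
    (normal_peak (sigma t) ^+ d * \sum_i
      ((B t * (x ord0 i) ^+ 2 / sigma t ^+ 2 - B t) * m t x (cst 1) +
       (A t - B t * alpha t) * x ord0 i / sigma t ^+ 2 *
         m t x (fun y => y ord0 i) -
       alpha t * A t / sigma t ^+ 2 * m t x (fun y => y ord0 i ^+ 2))).
Proof.
move=> t01.
have s0 := sigma_gt0 t01; have s0' : sigma t != 0 by rewrite gt_eqF.
have E : \forall s \near t, normal_peak (sigma s) ^+ d * m s x (cst 1) =
    marginal_pdf alpha sigma p1 s x.
  near=> s; have s01 : 0 < s < 1 by near: s; exact: near_in_oo01.
  by rewrite marginal_pdfE ?sigma_gt0 ?b_gt0.
apply: near_eq_is_derive E _.
have dX i : is_derive t 1 (fun s => X s x i) (- (B t * x ord0 i / sigma t)).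
  have := is_deriveM (is_derive_cst (x ord0 i : R) t 1) (dsigmaV t01).
  move/is_derive_eq; apply; rewrite scaler0 addr0 [LHS]mulrN; congr -%R.
  by rewrite mulrA (mulrC (x ord0 i)).
have cst1_le (y : 'rV[R]_d) : `|cst 1 y : R| <= 1 + norm1 y.
  by rewrite normr1 lerDl norm1_ge0.
have := is_deriveM (is_derive_peak t01)
  (is_derive_moment p1_ge0 p1_int dX (db t01) (b_gt0 t01)
    (measurable_cst (1 : R)) cst1_le).
move/is_derive_eq; apply.
(* The derivative of the exponent is expanded into powers of each [y_i]. *)
rewrite (_ : (fun y => - cst 1 y * _) = (fun y => \sum_i
   (B t * (x ord0 i) ^+ 2 / sigma t ^+ 2 +
    (A t - B t * alpha t) * x ord0 i / sigma t ^+ 2 * y ord0 i +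
    (- (alpha t * A t / sigma t ^+ 2)) * y ord0 i ^+ 2))); last first.
  apply/funext => y; rewrite mulr_sumr; apply: eq_bigr => i _.
  by rewrite /cst /X /b; field.
rewrite (moment_sum_quadratic p1_ge0 p1_int _ (b_gt0 t01)) -/(m t x _).
(* The term [- d B] from the peak is spread over the [d] coordinates, one [- B t] each, to match the
   divergence term by term. *)
have -> : \sum_i
      ((B t * (x ord0 i) ^+ 2 / sigma t ^+ 2 - B t) * m t x (cst 1) +
       (A t - B t * alpha t) * x ord0 i / sigma t ^+ 2 *
         m t x (fun y => y ord0 i) -
       alpha t * A t / sigma t ^+ 2 * m t x (fun y => y ord0 i ^+ 2)) =
  \sum_i (B t * x ord0 i ^+ 2 / sigma t ^+ 2 * m t x (cst 1) +
    (A t - B t * alpha t) * x ord0 i / sigma t ^+ 2 *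
         m t x (fun y => y ord0 i) +
    - (alpha t * A t / sigma t ^+ 2) * m t x (fun y => y ord0 i ^+ 2)) -
  d%:R * (B t * m t x (cst 1)).
  rewrite mulr_natl -[X in _ - _ *+ X](card_ord d) -sumr_const -sumrB.
  by apply: eq_bigr => i _; ring.
rewrite [RHS]mulrBr; refine (congr2 +%R _ _) => //.
by rewrite [LHS]mulrC; ring.
Unshelve. all: by end_near. Qed.

(** Along the i-th axis only [X i] moves, at speed [1 / sigma t], while [b] is constant; the
    derivative of a moment thus has weight [- w y * (X i - b * y_i) / sigma t]. *)
Lemma is_derive_flux t x i : 0 < t < 1 ->
  is_derive x (delta_mx ord0 i) (fun y => (marginal_pdf alpha sigma p1 t y *:
      marginal_velocity alpha sigma p1 t y) ord0 i : R)
    (normal_peak (sigma t) ^+ d *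
      ((B t - B t * (x ord0 i) ^+ 2 / sigma t ^+ 2) * m t x (cst 1) -
       (A t - B t * alpha t) * x ord0 i / sigma t ^+ 2 *
         m t x (fun y => y ord0 i) +
       alpha t * A t / sigma t ^+ 2 * m t x (fun y => y ord0 i ^+ 2))).
Proof.
move=> t01; apply: is_derive_line.
have s0 := sigma_gt0 t01; have s0' : sigma t != 0 by rewrite gt_eqF.
set e := delta_mx ord0 i.
have -> : (fun h : R => (marginal_pdf alpha sigma p1 t (h *: e + x) *:
      marginal_velocity alpha sigma p1 t (h *: e + x)) ord0 i : R) =
   (fun h => normal_peak (sigma t) ^+ d *
     ((B t * (h + x ord0 i)) * m t (h *: e + x) (cst 1) +
      A t * m t (h *: e + x) (fun y => y ord0 i))).
  by apply/funext => h; rewrite flux_coordE// !mxE !eqxx mulr1.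
have dX j : is_derive (0 : R) 1 (fun h : R => X t (h *: e + x) j)
    ((j == i)%:R / sigma t).
  have -> : (fun h : R => X t (h *: e + x) j) =
     (fun h : R => (h * (j == i)%:R + x ord0 j) * (sigma t)^-1).
    by apply/funext => h; rewrite /X !mxE eqxx.
  have := is_deriveM (is_deriveD (is_deriveM (is_derive_id (0 : R) 1)
      (is_derive_cst ((j == i)%:R : R) (0 : R) 1))
      (is_derive_cst (x ord0 j : R) (0 : R) 1))
      (is_derive_cst ((sigma t)^-1 : R) (0 : R) 1).
  move/is_derive_eq; apply.
  by rewrite !scaler0 !add0r addr0 [LHS]mulrC; congr (_ / _); exact: mulr1.
have cst1_le (y : 'rV[R]_d) : `|cst 1 y : R| <= 1 + norm1 y.
  by rewrite normr1 lerDl norm1_ge0.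
have coord_le (y : 'rV[R]_d) : `|y ord0 i| <= 1 + norm1 y.
  by rewrite (le_trans (le_norm1 y i))// lerDr.
have d1 := is_derive_moment p1_ge0 p1_int dX (is_derive_cst (b t : R) (0 : R) 1)
  (b_gt0 t01) (measurable_cst (1 : R)) cst1_le.
have d2 := is_derive_moment p1_ge0 p1_int dX (is_derive_cst (b t : R) (0 : R) 1)
  (b_gt0 t01) (measurable_rV_coord i) coord_le.
have dlin : is_derive (0 : R) 1 (fun h : R => B t * (h + x ord0 i)) (B t).
  have := is_deriveM (is_derive_cst (B t : R) (0 : R) 1)
    (is_deriveD (is_derive_id (0 : R) 1) (is_derive_cst (x ord0 i : R) (0 : R) 1)).
  by move/is_derive_eq; apply; rewrite scaler0 !addr0 [LHS]mulr1.
have := is_deriveZ (normal_peak (sigma t) ^+ d)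
  (is_deriveD (is_deriveM dlin d1) (is_deriveZ (A t) d2)).
move/is_derive_eq; apply.
have x0 : 0 *: e + x = x by rewrite scale0r add0r.
have sumE y : \sum_j (X t (0 *: e + x) j - cst (b t) (0 : R) * y ord0 j) *
    ((j == i)%:R / sigma t - 0 * y ord0 j) =
    (X t x i - b t * y ord0 i) / sigma t.
  rewrite x0 (bigD1 i)//= big1 ?addr0 ?eqxx ?mul0r ?subr0 ?mul1r// => j /negPf ->.
  by rewrite !mul0r subr0 mulr0.
have -> : (fun y : 'rV[R]_d => - cst 1 y * \sum_j
     (X t (0 *: e + x) j - cst (b t) (0 : R) * y ord0 j) *
     ((j == i)%:R / sigma t - 0 * y ord0 j)) =
  (fun y => - (x ord0 i / sigma t ^+ 2) + alpha t / sigma t ^+ 2 * y ord0 i +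
     0 * y ord0 i ^+ 2).
  by apply/funext => y; rewrite sumE /X /b /cst; field.
have -> : (fun y : 'rV[R]_d => - rV_coord i y * \sum_j
     (X t (0 *: e + x) j - cst (b t) (0 : R) * y ord0 j) *
     ((j == i)%:R / sigma t - 0 * y ord0 j)) =
  (fun y => 0 + - (x ord0 i / sigma t ^+ 2) * y ord0 i +
     alpha t / sigma t ^+ 2 * y ord0 i ^+ 2).
  by apply/funext => y; rewrite sumE /X /b /rV_coord; field.
rewrite !x0 !(m_quadratic _ _ _ _ _ t01).2 -!/(m t x _).
refine (congr2 *%R _ _) => //.
have scaleE (u v : R) : u *: v = u * v by [].
rewrite !scaleE /cst; set m1 := m _ _ _; set mX := m _ _ _; set mX2 := m _ _ _.
by field.
Qed.

(** The i-th summand of the time derivative is the opposite of the i-th partial derivative of the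
    flux. *)
Lemma continuity_equationP t x : 0 < t < 1 ->
  continuity_equation (marginal_pdf alpha sigma p1)
    (marginal_velocity alpha sigma p1) t x.
Proof.
move=> t01; have [dp pE] := is_derive_marginal_pdf x t01.
split; [exact: dp|by move=> i; case: (is_derive_flux x i t01)|].
rewrite derive1E pE /divergence [in RHS](eq_bigr (fun i => normal_peak (sigma t) ^+ d *
      ((B t - B t * (x ord0 i) ^+ 2 / sigma t ^+ 2) * m t x (cst 1) -
       (A t - B t * alpha t) * x ord0 i / sigma t ^+ 2 *
         m t x (fun y => y ord0 i) +
       alpha t * A t / sigma t ^+ 2 * m t x (fun y => y ord0 i ^+ 2)))) => [|i _].
  2: by have [_ E] := is_derive_flux x i t01; exact: E.
rewrite -[in RHS]mulr_sumr -[RHS]mulrN -[in RHS]sumrN; congr (_ * _).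
by apply: eq_bigr => i _; ring.
Qed.

End continuity.

(** * The endpoints *)

(** Differentiability implies continuity, also one-sidedly at 0 and 1: [f (u n) - f t] is a
    convergent quotient times [u n - t], which tends to 0. *)
Lemma schedule_cvg (R : realType) (f : R -> R) (t : R) (u : nat -> R) :
  differentiable_within `[0, 1]%classic f -> 0 <= t <= 1 ->
  (forall n, 0 < u n < 1) -> (forall n, u n != t) ->
  u n @[n --> \oo] --> t -> f (u n) @[n --> \oo] --> f t.
Proof.
move=> df t01 u01 ut u_t.
have /cvg_ex[/= l fl] :
    cvg ((f s - f t) / (s - t) @[s --> within `[0, 1]%classic t^']).
  by apply: df => /=; rewrite in_itv.
have uW : u n @[n --> \oo] --> within `[0, 1]%classic t^'.
  move=> P tP.
  have nP : \forall n \near \oo, u n != t -> `[0, 1]%classic (u n) -> P (u n).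
    exact: u_t tP.
  apply: filterS nP => n; apply; first exact: ut.
  by rewrite /= in_itv/=; move: (u01 n); lra.
have q_l : (f (u n) - f t) / (u n - t) @[n --> \oo] --> l := cvg_comp _ _ uW fl.
have u_t0 : u n - t @[n --> \oo] --> 0.
  rewrite -(subrr t); exact: (cvgB u_t (cvg_cst t)).
have -> : (fun n => f (u n)) =
    (fun n => (f (u n) - f t) / (u n - t) * (u n - t) + f t).
  by apply/funext => n; rewrite divfK ?subr_eq0// subrK.
rewrite -[X in _ --> X]add0r -(mulr0 l).
exact: cvgD (cvgM q_l u_t0) (cvg_cst (f t)).
Qed.

Section weak_endpoints.
Variables (R : realType) (d : nat) (alpha sigma : R -> R) (p1 : 'rV[R]_d -> R).
Hypothesis schedulesP : schedules alpha sigma.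
Hypothesis p1_density : is_density p1.
Implicit Types (t : R) (x y : 'rV[R]_d).

Let p1_ge0 y : 0 <= p1 y. Proof. by case: p1_density. Qed.
Let mp1 : measurable_fun setT p1. Proof. by case: p1_density. Qed.

Lemma measurable_cond_pdf t : measurable_fun setT
  (fun xy : 'rV[R]_d * 'rV[R]_d => cond_pdf alpha sigma t xy.2 xy.1).
Proof.
rewrite (_ : (fun xy => _) = gauss_pdf 0 (sigma t) \o
    (fun xy : 'rV[R]_d * 'rV[R]_d => 1 *: xy.1 + (- alpha t) *: xy.2)).
  exact: (measurableT_comp (measurable_gauss_pdf _ _) (measurable_lincomb _ _)).
apply/funext => xy /=; rewrite scale1r scaleNr.
exact: gauss_pdf_center.
Qed.

Let measurable_joint t : measurable_fun setT
  (fun xy : 'rV[R]_d * 'rV[R]_d => cond_pdf alpha sigma t xy.2 xy.1 * p1 xy.2).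
Proof.
apply: measurable_funM; first exact: measurable_cond_pdf.
exact: (measurableT_comp mp1 measurable_snd).
Qed.

Let joint_ge0 t x y : 0 <= cond_pdf alpha sigma t y x * p1 y.
Proof. by rewrite mulr_ge0// gauss_pdf_ge0. Qed.

Let marginal_pdf_EFin t x : 0 < t < 1 ->
  ((marginal_pdf alpha sigma p1 t x)%:E =
   \int[lebesgue_rV R d]_y (cond_pdf alpha sigma t y x * p1 y)%:E)%E.
Proof.
move=> t01; rewrite /marginal_pdf /Rintegral fineK//.
apply: integrable_fin_num => //.
by case: (marginals_well_definedP schedulesP p1_density x t01).
Qed.

Lemma measurable_marginal_pdf t : 0 < t < 1 ->
  measurable_fun setT (marginal_pdf alpha sigma p1 t).
Proof.
move=> t01; apply/measurable_EFinP; rewrite (_ : _ \o _ =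
    fubini_F (lebesgue_rV R d) (fun xy : 'rV[R]_d * 'rV[R]_d =>
      (cond_pdf alpha sigma t xy.2 xy.1 * p1 xy.2)%:E)); last first.
  by apply/funext => x; rewrite /= marginal_pdf_EFin.
apply: measurable_fun_fubini_tonelli_F.
  by apply/measurable_EFinP; exact: measurable_joint.
by move=> xy; rewrite lee_fin.
Qed.

(** After Tonelli the inner integral in x is against N(alpha_t y, sigma_t^2 I), and the affine
    substitution turns it into [mollify]. *)
Lemma integral_marginal_pdf (f : 'rV[R]_d -> R) M t : 0 < t < 1 ->
  continuous f -> (forall x, 0 <= f x <= M) ->
  (\int[lebesgue_rV R d]_x (f x * marginal_pdf alpha sigma p1 t x)%:E =
   \int[lebesgue_rV R d]_y (mollify f (alpha t) (sigma t) y * p1 y)%:E)%E.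
Proof.
move=> t01 cf fM; have f0 x : 0 <= f x by have /andP[] := fM x.
have mf := continuous_measurable_rV cf.
have s0 : 0 < sigma t by apply: (schedules_sigma_gt0 schedulesP).
pose h (xy : 'rV[R]_d * 'rV[R]_d) : \bar R :=
  (f xy.1 * (cond_pdf alpha sigma t xy.2 xy.1 * p1 xy.2))%:E.
have mh : measurable_fun setT h.
  apply/measurable_EFinP; apply: measurable_funM; last exact: measurable_joint.
  exact: (measurableT_comp mf measurable_fst).
have h0 xy : (0 <= h xy)%E by rewrite lee_fin mulr_ge0.
transitivity (\int[lebesgue_rV R d]_x \int[lebesgue_rV R d]_y h (x, y))%E.
  apply: eq_integral => x _; rewrite EFinM marginal_pdf_EFin//.
  rewrite -ge0_integralZl//.
  - apply/measurable_EFinP.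
    exact: (measurableT_comp (measurable_joint t) (measurable_pair1 x)).
  - by move=> y _; rewrite lee_fin.
  - by rewrite lee_fin.
rewrite (fubini_tonelli h mh h0); apply: eq_integral => y _.
rewrite EFinM (mollifyE cf fM) -(ge0_integral_gauss_pdf _ s0 mf f0).
rewrite -ge0_integralZr//.
- by apply: eq_integral => x _; rewrite -EFinM -mulrA.
- apply/measurable_EFinP; apply: measurable_funM => //.
  exact: measurable_gauss_pdf.
- by move=> x _; rewrite lee_fin mulr_ge0// gauss_pdf_ge0.
- by rewrite lee_fin.
Qed.

(** The total mass is obtained from the constant test function 1, whose mollification is 1. *)
Lemma is_density_marginal_pdf t : 0 < t < 1 ->
  is_density (marginal_pdf alpha sigma p1 t).
Proof.
move=> t01; split; first exact: measurable_marginal_pdf.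
  by move=> x; rewrite ltW// (marginal_pdf_gt0 schedulesP p1_density).
have c1 : continuous (cst 1 : 'rV[R]_d -> R) by exact: cst_continuous.
have b1 (x : 'rV[R]_d) : 0 <= (cst 1 x : R) <= 1 by rewrite /= ler01 lexx.
have := integral_marginal_pdf t01 c1 b1.
under eq_integral do rewrite /= mul1r.
move=> ->; have [_ _ <-] := p1_density.
apply: eq_integral => y _; rewrite /mollify.
by under eq_Rintegral do rewrite /= mul1r; rewrite Rintegral_gauss_pdf01 mul1r.
Qed.

Lemma Rintegral_marginal_pdf_cvg (f : 'rV[R]_d -> R) M (u : nat -> R) t :
  continuous f -> (forall x, 0 <= f x <= M) -> 0 <= t <= 1 ->
  (forall n, 0 < u n < 1) -> (forall n, u n != t) -> u n @[n --> \oo] --> t ->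
  \int[lebesgue_rV R d]_x (f x * marginal_pdf alpha sigma p1 (u n) x)
    @[n --> \oo] -->
  \int[lebesgue_rV R d]_y (mollify f (alpha t) (sigma t) y * p1 y).
Proof.
move=> cf fM t01 u01 ut u_t.
have -> : (fun n => \int[lebesgue_rV R d]_x
      (f x * marginal_pdf alpha sigma p1 (u n) x)) =
    (fun n => \int[lebesgue_rV R d]_y
      (mollify f (alpha (u n)) (sigma (u n)) y * p1 y)).
  apply/funext => n; congr fine.
  exact: integral_marginal_pdf (u01 n) cf fM.
exact: (Rintegral_mollify_cvg cf fM p1_density
  (schedule_cvg (schedules_alpha_diff schedulesP) t01 u01 ut u_t)
  (schedule_cvg (schedules_sigma_diff schedulesP) t01 u01 ut u_t)).
Qed.

(** In the limit alpha = 0 and sigma = 1, so the mollification no longer depends on [y] and [p1]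
    integrates to 1. *)
Lemma marginal_pdf_weak0 :
  weakly_converges 0^'+ (marginal_pdf alpha sigma p1) (gauss_pdf 0 1).
Proof.
apply: weakly_converges_ge0 (is_density_gauss_pdf01 R d) _.
  near=> t; apply: is_density_marginal_pdf; apply/andP; split; near: t.
    exact: nbhs_right_gt.
  exact: nbhs_right_lt.
move=> f M cf fM; apply/cvg_at_rightP => u [u0 u_0].
(* A sequence tending to 0 from the right may start beyond 1; shifting it by [N] puts it inside ]0,
   1[. *)
have [N _ uN] : \forall n \near \oo, u n < 1 by apply: (cvgr_lt _ u_0).
rewrite -(cvg_shiftn N).
have := @Rintegral_marginal_pdf_cvg f M (fun n => u (n + N)%N) 0 cf fM.
rewrite (schedules_alpha0 schedulesP) (schedules_sigma0 schedulesP).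
have [_ _ ip1] := p1_density.
under eq_Rintegral do rewrite mollify01.
rewrite (RintegralZl _ measurableT (density_integrable p1_density)).
rewrite [X in _ * X](_ : _ = 1) ?mulr1; last by rewrite /Rintegral ip1.
apply; first by rewrite lexx ler01.
- by move=> n; rewrite u0/= uN//=; exact: leq_addl.
- by move=> n; rewrite gt_eqF.
- by rewrite (cvg_shiftn N).
Unshelve. all: by end_near. Qed.

(** In the limit alpha = 1 and sigma = 0, where the mollification of [f] is [f] itself. *)
Lemma marginal_pdf_weak1 : weakly_converges 1^'- (marginal_pdf alpha sigma p1) p1.
Proof.
apply: weakly_converges_ge0 p1_density _.
  near=> t; apply: is_density_marginal_pdf; apply/andP; split; near: t.
    exact: nbhs_left_gt.
  exact: nbhs_left_lt.
move=> f M cf fM; apply/cvg_at_leftP => u [u1 u_1].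
have [N _ uN] : \forall n \near \oo, 0 < u n by apply: (cvgr_gt _ u_1).
rewrite -(cvg_shiftn N).
have := @Rintegral_marginal_pdf_cvg f M (fun n => u (n + N)%N) 1 cf fM.
rewrite (schedules_alpha1 schedulesP) (schedules_sigma1 schedulesP).
under eq_Rintegral do rewrite mollify10.
apply; first by rewrite lexx ler01.
- by move=> n; rewrite u1 andbT uN//=; exact: leq_addl.
- by move=> n; rewrite lt_eqF.
- by rewrite (cvg_shiftn N).
Unshelve. all: by end_near. Qed.

Lemma marginal_pdf0 x : marginal_pdf alpha sigma p1 0 x = gauss_pdf 0 1 x.
Proof.
rewrite /marginal_pdf /cond_pdf.
rewrite (schedules_alpha0 schedulesP) (schedules_sigma0 schedulesP).
under eq_Rintegral do rewrite scale0r.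
rewrite (RintegralZl _ measurableT (density_integrable p1_density)).
by have [_ _ ip1] := p1_density; rewrite /Rintegral ip1 mulr1.
Qed.

End weak_endpoints.

(** * The marginal velocity transports noise to data *)

Unset Implicit Arguments.

Theorem proposition8p2 (R : realType) (d : nat) (alpha sigma : R -> R)
    (p1 : 'rV[R]_d -> R)
    (schedulesP : schedules alpha sigma) (p1_density : is_density p1) :
  let p := marginal_pdf alpha sigma p1 in
  let u := marginal_velocity alpha sigma p1 in
  (forall (t : R) (x : 'rV[R]_d), 0 < t < 1 ->
     marginals_well_defined alpha sigma p1 t x /\ continuity_equation p u t x)
  /\ (forall x : 'rV[R]_d, p 0 x = gauss_pdf 0 1 x)
  /\ transports u p (p 0) p1.
Proof.
move=> p u; have cont t x : 0 < t < 1 -> continuity_equation p u t x.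
  exact: continuity_equationP.
split; first by move=> t x t01; split; [exact: marginals_well_definedP|exact: cont].
split; first exact: marginal_pdf0.
split; [exact: cont| |exact: marginal_pdf_weak1].
rewrite (_ : p 0 = gauss_pdf 0 1); first exact: marginal_pdf_weak0.
by apply/funext => x; exact: marginal_pdf0.
Qed.
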